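(* Let $\Phi:\mathbb{M}_n\to\mathbb{M}_l$ and $\Psi:\mathbb{M}_m\to\mathbb{M}_l$ be positive linear maps. Assume that $f\in\mathrm{OM}_{+,1}$ satisfies $f(x)^r\le f(x^r)$ for all $x\ge0$ and all $r\ge1$. Then for every $A\in\mathbb{M}_n^+$ and $B\in\mathbb{M}_m^+$, $$\bigl(\max\{\|\Phi(I_n)\|_\infty,\|\Psi(I_m)\|_\infty\}\bigr)^{r-1}\lambda_l\bigl(\Phi(A^r)\,\sigma_f\,\Psi(B^r)\bigr)\ge\lambda_l^r\bigl(\Phi(A)\,\sigma_f\,\Psi(B)\bigr)$$ for all $r\ge1$.
   Context: $\mathbb{M}_n$ is the algebra of $n\times n$ complex matrices and $\mathbb{M}_n^+$ the set of positive semidefinite matrices in $\mathbb{M}_n$; $\|\cdot\|_\infty$ is the operator norm; $A>0$ means $A$ is positive definite. A linear map $\Phi:\mathbb{M}_n\to\mathbb{M}_l$ is positive if $\Phi(A)\in\mathbb{M}_l^+$ for all $A\in\mathbb{M}_n^+$. Convention: $0^0:=1$. $\mathrm{OM}_{+,1}$ is the set of non-negative operator monotone functions $f$ on $[0,\infty)$ with $f(1)=1$. For $f\in\mathrm{OM}_{+,1}$ the associated (Kubo–Ando) operator mean $\sigma_f$ is defined by $A\,\sigma_f\,B:=A^{1/2}f(A^{-1/2}BA^{-1/2})A^{1/2}$ for $A,B\in\mathbb{M}_l^+$ with $A>0$, and extended to all $A,B\in\mathbb{M}_l^+$ by $A\,\sigma_f\,B:=\lim_{\varepsilon\searrow0}(A+\varepsilon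 I)\,\sigma_f\,(B+\varepsilon I)$. For $X\in\mathbb{M}_l^+$, $\lambda_1(X)\ge\dots\ge\lambda_l(X)$ are the eigenvalues of $X$ in decreasing order with multiplicities (so $\lambda_l(X)$ is the smallest), and $\lambda_l^r(X)=\lambda_l(X)^r$. *)

(* Defs.v *)
From HB Require Import structures.
From mathcomp Require Import all_boot all_order all_algebra.
From mathcomp Require Import all_classical all_reals all_analysis.
From mathcomp Require Import complex.

Set Implicit Arguments.
Unset Strict Implicit.
Unset Printing Implicit Defensive.

Import Order.TTheory GRing.Theory Num.Theory.
Import numFieldNormedType.Exports.

Local Open Scope ring_scope.
Local Open Scope complex_scope.
Local Open Scope sesquilinear_scope.
Local Open Scope classical_set_scope.

Definition psdmx (R : realType) (n : nat) (A : 'M[R[i]]_n) : Prop :=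
  A \is hermsymmx /\
  forall v : 'cV[R[i]]_n, 0 <= (v ^t* *m A *m v) ord0 ord0.

Definition loewner_le (R : realType) (n : nat) (A B : 'M[R[i]]_n) : Prop :=
  psdmx (B - A).

Definition positive_map (R : realType) (n l : nat)
    (Phi : 'M[R[i]]_n -> 'M[R[i]]_l) : Prop :=
  forall A : 'M[R[i]]_n, psdmx A -> psdmx (Phi A).

(* Functional calculus f(A) of a Hermitian matrix A.  The rows of spectralmx A
   form an orthonormal eigenbasis and spectral_diag A lists the corresponding
   (real) eigenvalues; the value is meaningful for Hermitian A only. *)
Definition mxfun (R : realType) (n : nat) (f : R -> R) (A : 'M[R[i]]_n)
    : 'M[R[i]]_n :=
  invmx (spectralmx A)
    *m diag_mx (map_mx (fun z : R[i] => (f (complex.Re z))%:C)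
                       (spectral_diag A))
    *m spectralmx A.

(* The library's convention for real powers gives 0 `^ 0 = 1. *)
Definition mxpow (R : realType) (n : nat) (A : 'M[R[i]]_n) (r : R)
    : 'M[R[i]]_n :=
  mxfun (fun x => x `^ r) A.

(* A function on [0, +oo[ is represented by a total function R -> R of which
   only the values at nonnegative reals are relevant.  Continuity at 0 is not
   required. *)
Definition operator_monotone (R : realType) (f : R -> R) : Prop :=
  forall (k : nat) (A B : 'M[R[i]]_k), psdmx A -> psdmx B ->
    loewner_le A B -> loewner_le (mxfun f A) (mxfun f B).

Definition OM_plus1 (R : realType) (f : R -> R) : Prop :=
  [/\ forall x, 0 <= x -> 0 <= f x, operator_monotone f & f 1 = 1].

(* A^{1/2} f(A^{-1/2} B A^{-1/2}) A^{1/2}, meaningful for A > 0. *)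
Definition opmean_pos (R : realType) (l : nat) (f : R -> R)
    (A B : 'M[R[i]]_l) : 'M[R[i]]_l :=
  mxpow A (2^-1)
    *m mxfun f (mxpow A (- 2^-1) *m B *m mxpow A (- 2^-1))
    *m mxpow A (2^-1).

(* The operator mean on all pairs of positive semidefinite matrices, as the
   limit of opmean_pos (A + e I) (B + e I) when e decreases to 0.  When A > 0
   and f is continuous on [0, +oo[ this limit is opmean_pos f A B itself.
   R[i]^o carries the usual topology of the complex plane. *)
Definition opmean (R : realType) (l : nat) (f : R -> R)
    (A B : 'M[R[i]]_l) : 'M[R[i]]_l :=
  lim ((fun e : R => (opmean_pos f (A + (e%:C)%:M) (B + (e%:C)%:M)
          : 'M[R[i]^o]_l)) @ 0^'+).

Definition cvnorm (R : realType) (n : nat) (v : 'cV[R[i]]_n) : R :=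
  Num.sqrt (\sum_(i < n) Normc.normc (v i ord0) ^+ 2).

Definition opnorm (R : realType) (n : nat) (A : 'M[R[i]]_n) : R :=
  sup [set cvnorm (A *m v) | v in [set v : 'cV[R[i]]_n | cvnorm v <= 1]].

(* Roots of the characteristic polynomial, listed with multiplicity. *)
Definition eigenvalues (R : realType) (n : nat) (A : 'M[R[i]]_n)
    : seq R[i] :=
  sval (closed_field_poly_normal (char_poly A)).

(* k-th largest eigenvalue of a Hermitian matrix, numbered from k = 1. *)
Definition lambda (R : realType) (n : nat) (k : nat) (A : 'M[R[i]]_n) : R :=
  nth 0 (sort (fun x y : R => y <= x)
           [seq complex.Re z | z <- eigenvalues A]) k.-1.

(* Main.v *)
(* For [f] operator monotone and nonnegative, a 2x2 block comparison gives
   Hansen's inequality [C* f(X) C <= f(C* X C)] for contractions [C], hence the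
   joint monotonicity of the mean and the existence of the limit defining it.
   Loewner-Heinz gives [(C* X C)^r <= C* X^r C] for [1 <= r <= 2], and therefore
   [Phi(A)^r <= c^(r-1) Phi(A^r)] whenever [Phi(I) <= c], because on the spectral
   projections of [A] a positive map is a compression.  The hypothesis on [f]
   yields the Ando-Hiai implication [A sigma B >= t ==> A^r sigma B^r >= t^r] for
   [1 <= r <= 2].  These combine to the theorem for [1 <= r <= 2], and the
   inequality is multiplicative in [r], so halving [r] repeatedly settles all
   [r >= 1]. *)

Require Import Defs.
From HB Require Import structures.
From mathcomp Require Import all_boot all_order all_algebra.
From mathcomp Require Import all_classical all_reals all_analysis.
From mathcomp Require Import complex.
From mathcomp Require Import ring lra.

Set Implicit Arguments.
Unset Strict Implicit.
Unset Printing Implicit Defensive.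

Import Order.TTheory GRing.Theory Num.Theory.
Import numFieldNormedType.Exports.

Local Open Scope ring_scope.
Local Open Scope complex_scope.

(** * Functional calculus *)

#[local] Opaque spectralmx spectral_diag.
Local Open Scope sesquilinear_scope.

(** Operator monotonicity of [f] enters only through its definition: there is no integral
    representation to draw on, and [f] may jump at 0. Inequalities for [f] therefore first appear
    with a factor [1 + e], which is removed by [f (s x) <= s f x] for [s >= 1], itself a consequence
    of the 1x1 case of the inequality with slack. For the same reason the mean is handled only as
    the decreasing limit of [opmean_pos] at shifted arguments: a smallest eigenvalue is the best
    scalar lower bound, and scalar lower bounds pass to such a limit and back. The range
    [1 <= r <= 2] comes from Loewner-Heinz, which allows only exponents [s] in [[0, 1]]: each power
    [1 + s] is rewritten, by [(Z' Z)^(1+s) = Z' (Z Z')^s Z] with [Z'] the adjoint or by splitting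
    off [A^(1/2)] on both sides, until only a power [s] is compared. Doubling the exponent costs
    nothing in the constant, as [c^((2-1)q) c^(q-1) = c^(2q-1)]. *)

Section Adjoint.
Context {R : realType}.
Local Notation C := R[i].

Lemma adj_mul m n p (A : 'M[C]_(m, n)) (B : 'M[C]_(n, p)) :
  (A *m B) ^t* = B ^t* *m A ^t*.
Proof. by rewrite trmx_mul map_mxM. Qed.

Lemma adj_congr m n (Z : 'M[C]_(m, n)) (A : 'M[C]_m) :
  (Z ^t* *m A *m Z) ^t* = Z ^t* *m A ^t* *m Z.
Proof. by rewrite !adj_mul trmxCK mulmxA. Qed.

Lemma adj_add m n (A B : 'M[C]_(m, n)) : (A + B) ^t* = A ^t* + B ^t*.
Proof. by rewrite linearD map_mxD. Qed.

Lemma adj_sub m n (A B : 'M[C]_(m, n)) : (A - B) ^t* = A ^t* - B ^t*.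
Proof. by rewrite linearB map_mxB. Qed.

Lemma conj_real (a : R) : Num.conj (a%:C : C) = a%:C.
Proof. by rewrite conj_Creal// complex_real eqxx. Qed.

Lemma adj_scale m n (a : R) (A : 'M[C]_(m, n)) :
  (a%:C *: A) ^t* = a%:C *: A ^t*.
Proof. by rewrite linearZ map_mxZ /= conj_real. Qed.

Lemma adj_scalar n (a : R) : (a%:C%:M : 'M[C]_n) ^t* = a%:C%:M.
Proof. by rewrite tr_scalar_mx map_scalar_mx /= conj_real. Qed.

Lemma adj1 n : (1%:M : 'M[C]_n) ^t* = 1%:M.
Proof. by rewrite tr_scalar_mx map_scalar_mx /= rmorph1. Qed.

Lemma adj0 m n : (0 : 'M[C]_(m, n)) ^t* = 0.
Proof. by rewrite trmx0 map_mx0. Qed.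

Lemma hermP n (A : 'M[C]_n) : A \is hermsymmx <-> A ^t* = A.
Proof.
split; first by move=> /is_hermitianmxP; rewrite expr0 scale1r => <-.
by move=> h; apply/is_hermitianmxP; rewrite expr0 scale1r; exact/esym.
Qed.

End Adjoint.

Section PsdMatrices.
Context {R : realType}.
Local Notation C := R[i].

Lemma psd_herm n (A : 'M[C]_n) : psdmx A -> A ^t* = A.
Proof. by case=> /hermP. Qed.

Lemma psd0 n : psdmx (0 : 'M[C]_n).
Proof.
split; first by apply/hermP; rewrite adj0.
by move=> v; rewrite mulmx0 mul0mx mxE.
Qed.

Lemma psdD n (A B : 'M[C]_n) : psdmx A -> psdmx B -> psdmx (A + B).
Proof.
move=> [/hermP hA pA] [/hermP hB pB]; split.
  by apply/hermP; rewrite adj_add hA hB.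
by move=> v; rewrite mulmxDr mulmxDl mxE addr_ge0.
Qed.

Lemma psdZ n (a : R) (A : 'M[C]_n) : 0 <= a -> psdmx A -> psdmx (a%:C *: A).
Proof.
move=> a0 [/hermP hA pA]; split.
  by apply/hermP; rewrite adj_scale hA.
by move=> v; rewrite -scalemxAr -scalemxAl mxE mulr_ge0// ler0c.
Qed.

Lemma psd_congr m n (Z : 'M[C]_(m, n)) (A : 'M[C]_m) :
  psdmx A -> psdmx (Z ^t* *m A *m Z).
Proof.
move=> [/hermP hA pA]; split.
  by apply/hermP; rewrite !adj_mul trmxCK hA mulmxA.
by move=> v; have := pA (Z *m v); rewrite adj_mul !mulmxA.
Qed.

Definition rdiag n (d : 'I_n -> R) : 'M[C]_n := diag_mx (\row_j (d j)%:C).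

Lemma adj_rdiag n (d : 'I_n -> R) : (rdiag d) ^t* = rdiag d.
Proof.
rewrite /rdiag tr_diag_mx map_diag_mx; congr diag_mx.
by apply/rowP => j; rewrite !mxE; apply: conj_real.
Qed.

Lemma rdiag_mul n (d e : 'I_n -> R) :
  rdiag d *m rdiag e = rdiag (fun j => d j * e j).
Proof.
rewrite /rdiag mulmx_diag; congr diag_mx.
by apply/rowP => j; rewrite !mxE rmorphM.
Qed.

Lemma rdiag_add n (d e : 'I_n -> R) :
  rdiag d + rdiag e = rdiag (fun j => d j + e j).
Proof.
rewrite /rdiag -linearD; congr diag_mx.
by apply/rowP => j; rewrite !mxE rmorphD.
Qed.

Lemma rdiag_sub n (d e : 'I_n -> R) :
  rdiag d - rdiag e = rdiag (fun j => d j - e j).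
Proof.
rewrite /rdiag -linearB; congr diag_mx.
by apply/rowP => j; rewrite !mxE rmorphB.
Qed.

Lemma rdiag_scale n (a : R) (d : 'I_n -> R) :
  a%:C *: rdiag d = rdiag (fun j => a * d j).
Proof.
rewrite /rdiag -linearZ; congr diag_mx.
by apply/rowP => j; rewrite !mxE rmorphM.
Qed.

Lemma rdiag_cst n (a : R) : rdiag (fun _ : 'I_n => a) = a%:C%:M.
Proof.
by rewrite /rdiag -diag_const_mx; congr diag_mx; apply/rowP => j; rewrite !mxE.
Qed.

Lemma eq_rdiag n (d e : 'I_n -> R) : d =1 e -> rdiag d = rdiag e.
Proof. by move=> h; congr diag_mx; apply/rowP => j; rewrite !mxE h. Qed.

Lemma psd_rdiag n (d : 'I_n -> R) : psdmx (rdiag d) <-> forall j, 0 <= d j.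
Proof.
split.
  move=> [_ h] j; have := h (delta_mx j 0).
  rewrite /rdiag mul_mx_diag mxE (bigD1 j)//= big1 => [|k /negPf kj].
    by rewrite !mxE !eqxx rmorph1 mul1r mulr1 addr0 ler0c.
  by rewrite !mxE kj mulr0.
move=> h; split; first by apply/hermP; rewrite adj_rdiag.
move=> v; rewrite /rdiag mul_mx_diag mxE sumr_ge0// => j _.
rewrite !mxE mulrAC mulr_ge0 ?ler0c//.
by rewrite mulrC mul_conjC_ge0.
Qed.

Lemma psd_scalar n (a : R) : 0 <= a -> psdmx (a%:C%:M : 'M[C]_n).
Proof. by rewrite -rdiag_cst psd_rdiag. Qed.

Lemma psd1 n : psdmx (1%:M : 'M[C]_n).
Proof. exact: (psd_scalar n ler01). Qed.

Lemma psd_gram m n (Z : 'M[C]_(m, n)) : psdmx (Z ^t* *m Z).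
Proof. by have := psd_congr Z (psd1 m); rewrite mulmx1. Qed.

Lemma loewnerE n (A B : 'M[C]_n) : loewner_le A B = psdmx (B - A).
Proof. by []. Qed.

Lemma loewner_refl n (A : 'M[C]_n) : loewner_le A A.
Proof. by rewrite /loewner_le subrr; apply: psd0. Qed.

Lemma loewner_trans n (B A D : 'M[C]_n) :
  loewner_le A B -> loewner_le B D -> loewner_le A D.
Proof.
by move=> AB BD; have := psdD BD AB; rewrite addrA subrK.
Qed.

Lemma loewner_add n (A B D E : 'M[C]_n) :
  loewner_le A B -> loewner_le D E -> loewner_le (A + D) (B + E).
Proof. by move=> AB DE; have := psdD AB DE; rewrite addrACA -opprD. Qed.

Lemma loewner_scale n (a : R) (A B : 'M[C]_n) : 0 <= a ->
  loewner_le A B -> loewner_le (a%:C *: A) (a%:C *: B).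
Proof. by move=> a0 AB; have := psdZ a0 AB; rewrite scalerBr. Qed.

Lemma loewner_congr m n (Z : 'M[C]_(m, n)) (A B : 'M[C]_m) :
  loewner_le A B -> loewner_le (Z ^t* *m A *m Z) (Z ^t* *m B *m Z).
Proof. by move=> AB; have := psd_congr Z AB; rewrite mulmxBr mulmxBl. Qed.

Lemma loewner_psd n (A B : 'M[C]_n) : psdmx A -> loewner_le A B -> psdmx B.
Proof. by move=> pA AB; have := psdD AB pA; rewrite subrK. Qed.

Lemma loewner0 n (A : 'M[C]_n) : psdmx A <-> loewner_le 0 A.
Proof. by rewrite /loewner_le subr0. Qed.

Lemma loewner_scalar n (a b : R) :
  a <= b -> loewner_le (a%:C%:M : 'M[C]_n) b%:C%:M.
Proof.
by move=> ab; rewrite /loewner_le -raddfB -rmorphB; apply: psd_scalar; rewrite subr_ge0.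
Qed.

End PsdMatrices.

Section FunctionalCalculus.
Context {R : realType}.
Local Notation C := R[i].
Implicit Types f g : R -> R.

Definition spectrum n (A : 'M[C]_n) (j : 'I_n) : R :=
  complex.Re (spectral_diag A 0 j).

Lemma spectralmxV n (A : 'M[C]_n) : invmx (spectralmx A) = (spectralmx A) ^t*.
Proof. exact/invmx_unitary/spectral_unitarymx. Qed.

Lemma spectral_adjM n (A : 'M[C]_n) : (spectralmx A) ^t* *m spectralmx A = 1%:M.
Proof. by rewrite -spectralmxV mulVmx// spectral_unit. Qed.

Lemma spectral_Madj n (A : 'M[C]_n) : spectralmx A *m (spectralmx A) ^t* = 1%:M.
Proof. by rewrite -spectralmxV mulmxV// spectral_unit. Qed.

Lemma mxpowE n (A : 'M[C]_n) r : mxpow A r = mxfun (fun x => x `^ r) A.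
Proof. by []. Qed.

Lemma mxfunE n f (A : 'M[C]_n) : mxfun f A =
  (spectralmx A) ^t* *m rdiag (fun j => f (spectrum A j)) *m spectralmx A.
Proof.
have E : map_mx (fun z => (f (complex.Re z))%:C) (spectral_diag A) =
  \row_j (f (spectrum A j))%:C by apply/rowP => j; rewrite !mxE.
by rewrite /mxfun spectralmxV E.
Qed.

Lemma hermE n (A : 'M[C]_n) : A ^t* = A ->
  A = (spectralmx A) ^t* *m rdiag (spectrum A) *m spectralmx A.
Proof.
move=> /hermP hA; have /orthomx_spectralP := hermitian_normalmx hA.
rewrite spectralmxV => {1}->.
suff -> : spectral_diag A = \row_j (spectrum A j)%:C by [].
apply/rowP => j; rewrite !mxE RRe_real//.
exact: (mxOverP (hermitian_spectral_diag_real hA)).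
Qed.

Lemma spectral_mull n (A : 'M[C]_n) : A ^t* = A ->
  spectralmx A *m A = rdiag (spectrum A) *m spectralmx A.
Proof. by move=> /hermE {2}->; rewrite !mulmxA spectral_Madj mul1mx. Qed.

Lemma spectral_mulr n (A : 'M[C]_n) : A ^t* = A ->
  A *m (spectralmx A) ^t* = (spectralmx A) ^t* *m rdiag (spectrum A).
Proof.
by move=> /hermE {1}->; rewrite (mulmxtVK _ (spectral_unitarymx A)).
Qed.

Lemma mxfun_herm n f (A : 'M[C]_n) : (mxfun f A) ^t* = mxfun f A.
Proof. by rewrite mxfunE !adj_mul trmxCK adj_rdiag mulmxA. Qed.

Lemma eq_mxfun n f g (A : 'M[C]_n) :
  (forall j, f (spectrum A j) = g (spectrum A j)) -> mxfun f A = mxfun g A.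
Proof. by move=> h; rewrite !mxfunE (eq_rdiag h). Qed.

Lemma mxfun_id n (A : 'M[C]_n) : A ^t* = A -> mxfun id A = A.
Proof. by move=> hA; rewrite mxfunE -hermE. Qed.

Lemma mxfunM n f g (A : 'M[C]_n) :
  mxfun f A *m mxfun g A = mxfun (fun x => f x * g x) A.
Proof.
rewrite !mxfunE -rdiag_mul !mulmxA.
by rewrite (mulmxtVK _ (spectral_unitarymx A)).
Qed.

Lemma mxfunD n f g (A : 'M[C]_n) :
  mxfun f A + mxfun g A = mxfun (fun x => f x + g x) A.
Proof. by rewrite !mxfunE -rdiag_add mulmxDr mulmxDl. Qed.

Lemma mxfunB n f g (A : 'M[C]_n) :
  mxfun f A - mxfun g A = mxfun (fun x => f x - g x) A.
Proof. by rewrite !mxfunE -rdiag_sub mulmxBr mulmxBl. Qed.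

Lemma mxfunZ n (a : R) f (A : 'M[C]_n) :
  a%:C *: mxfun f A = mxfun (fun x => a * f x) A.
Proof. by rewrite !mxfunE -rdiag_scale -scalemxAr -scalemxAl. Qed.

Lemma mxfun_cst n (a : R) (A : 'M[C]_n) : mxfun (fun=> a) A = a%:C%:M.
Proof.
by rewrite mxfunE rdiag_cst scalar_mxC -mulmxA spectral_adjM mulmx1.
Qed.

Lemma psd_mxfun n f (A : 'M[C]_n) :
  psdmx (mxfun f A) <-> forall j, 0 <= f (spectrum A j).
Proof.
rewrite -psd_rdiag; split=> [h|]; last by rewrite mxfunE; apply: psd_congr.
have := psd_congr ((spectralmx A) ^t*) h.
rewrite mxfunE trmxCK !mulmxA spectral_Madj mul1mx.
by rewrite -mulmxA spectral_Madj mulmx1.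
Qed.

Lemma loewner_mxfun n f g (A : 'M[C]_n) :
  loewner_le (mxfun f A) (mxfun g A) <->
  forall j, f (spectrum A j) <= g (spectrum A j).
Proof.
rewrite /loewner_le mxfunB psd_mxfun.
by split=> h j; have := h j; rewrite subr_ge0.
Qed.

Lemma spectrum_ge n (a : R) (A : 'M[C]_n) : A ^t* = A ->
  loewner_le a%:C%:M A <-> forall j, a <= spectrum A j.
Proof. by move=> hA; rewrite -(mxfun_cst a A) -{2}(mxfun_id hA) loewner_mxfun. Qed.

Lemma spectrum_le n (a : R) (A : 'M[C]_n) : A ^t* = A ->
  loewner_le A a%:C%:M <-> forall j, spectrum A j <= a.
Proof. by move=> hA; rewrite -(mxfun_cst a A) -{1}(mxfun_id hA) loewner_mxfun. Qed.

Lemma spectrum_ge0 n (A : 'M[C]_n) (j : 'I_n) : psdmx A -> 0 <= spectrum A j.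
Proof.
by move=> pA; apply: ((psd_mxfun id A).1 _ j); rewrite mxfun_id// psd_herm.
Qed.

Lemma rdiag_intertwine m n f (a : 'I_m -> R) (b : 'I_n -> R) (W : 'M[C]_(m, n)) :
  rdiag a *m W = W *m rdiag b ->
  rdiag (fun j => f (a j)) *m W = W *m rdiag (fun j => f (b j)).
Proof.
move=> WE; apply/matrixP => i j; move/matrixP/(_ i j): WE.
rewrite /rdiag !mul_mx_diag !mul_diag_mx !mxE.
move: (W i j) => w; rewrite ![_ * w]mulrC => /eqP.
have [->|w0] := eqVneq w 0; first by rewrite !mul0r.
by rewrite (inj_eq (mulfI w0)) => /eqP /complexI ->.
Qed.

(* Entrywise, [a_i w_ij = w_ij b_j] in the two eigenbases, so [w_ij] also
   intertwines [f a_i] and [f b_j]. *)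
Lemma mxfun_intertwine m n f (A : 'M[C]_m) (B : 'M[C]_n) (Z : 'M[C]_(m, n)) :
  A ^t* = A -> B ^t* = B -> A *m Z = Z *m B ->
  mxfun f A *m Z = Z *m mxfun f B.
Proof.
move=> hA hB AZ.
pose W := spectralmx A *m Z *m (spectralmx B) ^t*.
have WE : rdiag (spectrum A) *m W = W *m rdiag (spectrum B).
  rewrite /W !mulmxA -(spectral_mull hA) -[RHS]mulmxA -(spectral_mulr hB).
  by rewrite mulmxA -(mulmxA _ A) AZ !mulmxA.
have fW : rdiag (fun j => f (spectrum A j)) *m W =
          W *m rdiag (fun j => f (spectrum B j)).
  exact: rdiag_intertwine.
have uA := spectral_unitarymx A; have uB := spectral_unitarymx B.
have -> : Z = (spectralmx A) ^t* *m W *m spectralmx B.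
  by rewrite /W !mulmxA spectral_adjM mul1mx mulmxKtV.
clearbody W.
rewrite !mxfunE !mulmxA (mulmxtVK _ uA) (mulmxtVK _ uB).
by rewrite -(mulmxA _ _ W) fW !mulmxA.
Qed.

(** The eigenbasis that [spectralmx] picks for a diagonal matrix need not be the standard one. Each
    basis vector [e_j] intertwines [rdiag d] with the 1x1 matrix [d j], so column [j] of the result
    can be computed there. *)
Lemma mxfun_rdiag n f (d : 'I_n -> R) : mxfun f (rdiag d) = rdiag (fun j => f (d j)).
Proof.
apply/matrixP => i j.
have dE : rdiag d *m delta_mx j 0 =
         delta_mx j 0 *m rdiag (fun _ : 'I_1 => d j).
  apply/matrixP => k l; rewrite /rdiag mul_diag_mx mul_mx_diag !mxE.
  by have [->|] := eqVneq k j; rewrite ?mulr0 ?mul0r// mulrC.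
have := mxfun_intertwine f (adj_rdiag _) (adj_rdiag _) dE.
rewrite -colE.
have -> : mxfun f (rdiag (fun _ : 'I_1 => d j)) = (f (d j))%:C%:M.
  set E := rdiag _.
  have hE : E = (spectrum E 0)%:C%:M.
    have /hermE {1}-> : E ^t* = E by apply: adj_rdiag.
    rewrite -rdiag_cst.
    have -> : rdiag (spectrum E) = rdiag (fun=> spectrum E 0).
      by apply: eq_rdiag => k; rewrite ord1.
    by rewrite rdiag_cst scalar_mxC -mulmxA spectral_adjM mulmx1.
  have sE : spectrum E 0 = d j.
    apply/complexI; move/matrixP/(_ 0 0): hE.
    by rewrite !mxE eqxx !mulr1n.
  rewrite -(mxfun_cst _ E); apply: eq_mxfun => k.
  by rewrite ord1 sE.
move=> /matrixP /(_ i 0); rewrite mul_mx_scalar !mxE => ->.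
rewrite eqxx andbT; have [->|_] := eqVneq i j; first by rewrite mulr1 mulr1n.
by rewrite mulr0 mulr0n.
Qed.

(** [mxfun g A] has its own [spectralmx], with no known relation to that of [A]; intertwining
    through the eigenbasis of [A] avoids comparing the two. *)
Lemma mxfun_comp n f g (A : 'M[C]_n) :
  mxfun f (mxfun g A) = mxfun (f \o g) A.
Proof.
have gU : mxfun g A *m (spectralmx A) ^t* =
          (spectralmx A) ^t* *m rdiag (fun j => g (spectrum A j)).
  by rewrite mxfunE (mulmxtVK _ (spectral_unitarymx A)).
have := mxfun_intertwine f (mxfun_herm g A) (adj_rdiag _) gU.
rewrite mxfun_rdiag => /(congr1 (fun X => X *m spectralmx A)).
by rewrite -mulmxA spectral_adjM mulmx1 => ->; rewrite mxfunE.
Qed.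

End FunctionalCalculus.

#[local] Opaque loewner_le mxfun mxpow.

(** * Quadratic forms, closedness of the Loewner order, positive definite matrices *)

Section QuadraticForm.
Context {R : realType}.
Local Notation C := R[i].

(** Only the real part is kept: on Hermitian matrices the form is real, and real values make order
    and limit arguments available. *)
Definition qform n (A : 'M[C]_n) (v : 'cV[C]_n) : R :=
  complex.Re ((v ^t* *m A *m v) 0 0).

Lemma qformD n (A B : 'M[C]_n) v : qform (A + B) v = qform A v + qform B v.
Proof. by rewrite /qform mulmxDr mulmxDl mxE raddfD. Qed.

Lemma qformB n (A B : 'M[C]_n) v : qform (A - B) v = qform A v - qform B v.
Proof. by rewrite /qform mulmxBr mulmxBl !mxE raddfB. Qed.

Lemma qformZ n (a : R) (A : 'M[C]_n) v : qform (a%:C *: A) v = a * qform A v.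
Proof.
rewrite /qform -scalemxAr -scalemxAl mxE.
by case: (_ 0 0) => x y; rewrite /= mul0r subr0.
Qed.

Lemma psdP n (A : 'M[C]_n) : A ^t* = A ->
  psdmx A <-> forall v, 0 <= qform A v.
Proof.
move=> hA; split.
  by move=> [_ h] v; have := h v; rewrite lecE => /andP[].
move=> h; split; first exact/hermP.
move=> v; rewrite lecE h andbT.
have : Num.conj ((v ^t* *m A *m v) ord0 ord0) = (v ^t* *m A *m v) ord0 ord0.
  transitivity (((v ^t* *m A *m v) ^t*) ord0 ord0); first by rewrite !mxE.
  by rewrite !adj_mul trmxCK hA mulmxA.
by move=> /CrealP; case: (_ ord0 ord0) => x y; rewrite complex_real.
Qed.

End QuadraticForm.

#[local] Opaque psdmx.

Section LoewnerOrder.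
Context {R : realType}.
Local Notation C := R[i].

Lemma qform_ge0 n (A : 'M[C]_n) v : psdmx A -> 0 <= qform A v.
Proof. by move=> pA; move: v; apply/psdP => //; apply: psd_herm. Qed.

Lemma loewnerP n (A B : 'M[C]_n) : A ^t* = A -> B ^t* = B ->
  loewner_le A B <-> forall v, qform A v <= qform B v.
Proof.
move=> hA hB; have hBA : (B - A) ^t* = B - A by rewrite adj_sub hA hB.
rewrite loewnerE (psdP hBA).
by split=> h v; have := h v; rewrite qformB subr_ge0.
Qed.

(** A multiple [e D] of a fixed matrix is negligible because the order can be tested on one vector
    at a time. *)
Lemma loewner_closed n (A B D : 'M[C]_n) : A ^t* = A -> B ^t* = B ->
  psdmx D -> (forall e, 0 < e -> loewner_le A (B + e%:C *: D)) ->
  loewner_le A B.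
Proof.
move=> hA hB pD h; apply/loewnerP => // v; apply/ler_addgt0Pr => e e0.
have d0 := qform_ge0 v pD.
(* The [+ 1] keeps the denominator positive when the form of [D] vanishes at [v]. *)
have k0 : 0 < e / (qform D v + 1) by rewrite divr_gt0// ltr_wpDl.
have hk : (B + (e / (qform D v + 1))%:C *: D) ^t* =
           B + (e / (qform D v + 1))%:C *: D.
  by rewrite adj_add adj_scale hB (psd_herm pD).
have /(loewnerP hA hk)/(_ v) /le_trans-> // := h _ k0.
rewrite qformD qformZ lerD2l -mulrA ger_pMr// mulrC ler_pdivrMr ?mul1r ?lerDl//.
by rewrite ltr_wpDl.
Qed.

Lemma loewner_scalarP n (a b : R) :
  loewner_le (a%:C%:M : 'M[C]_n.+1) b%:C%:M -> a <= b.
Proof.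
rewrite -!rdiag_cst loewnerE rdiag_sub => /psd_rdiag /(_ 0).
by rewrite subr_ge0.
Qed.

(** With [P = Z Z'] and [Q = Z' Z], where [Z'] is the adjoint, [1 - P = (1 - P)^2 + Z (1 - Q) Z'] is
    a sum of two positive terms. *)
Lemma contraction_adj m n (Z : 'M[C]_(m, n)) :
  loewner_le (Z ^t* *m Z) 1%:M -> loewner_le (Z *m Z ^t*) 1%:M.
Proof.
move=> h; rewrite loewnerE.
have -> : 1%:M - Z *m Z ^t* =
    (1%:M - Z *m Z ^t*) ^t* *m (1%:M - Z *m Z ^t*) +
    (Z ^t*) ^t* *m (1%:M - Z ^t* *m Z) *m Z ^t*.
  rewrite adj_sub adj1 adj_mul !trmxCK !(mulmxBl, mulmxBr) !mulmx1 !mul1mx.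
  by rewrite !mulmxA subrK.
by apply: psdD; [apply: psd_gram | apply: psd_congr].
Qed.

(** A scalar lower bound, equivalent in finite dimension to strict positivity of the form, and
    directly inherited by larger matrices. *)
Definition pdmx n (A : 'M[C]_n) : Prop := exists2 e : R, 0 < e & loewner_le e%:C%:M A.

Lemma pd_psd n (A : 'M[C]_n) : pdmx A -> psdmx A.
Proof. by case=> e /ltW e0; apply: loewner_psd; apply: psd_scalar. Qed.

Lemma pd_le n (A B : 'M[C]_n) : pdmx A -> loewner_le A B -> pdmx B.
Proof. by case=> e e0 eA AB; exists e; [exact: e0 | exact: loewner_trans eA AB]. Qed.

Lemma psd_pdD n (A : 'M[C]_n) (e : R) : psdmx A -> 0 < e -> pdmx (A + e%:C%:M).
Proof. by move=> pA e0; exists e; [exact: e0 | rewrite loewnerE addrK]. Qed.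

Lemma spectrum_gt0 n (A : 'M[C]_n) j : pdmx A -> 0 < spectrum A j.
Proof.
move=> pA; have hA := psd_herm (pd_psd pA); case: pA => e e0.
by move=> /(spectrum_ge _ hA) /(_ j); apply: lt_le_trans.
Qed.

Lemma spectrum_lbound n (A : 'I_n -> R) :
  (forall j, 0 < A j) -> exists2 e : R, 0 < e & forall j, e <= A j.
Proof.
move=> h; exists (\big[Num.min/1]_j A j).
  by apply: lt_bigmin.
by move=> j; apply: bigmin_le.
Qed.

Lemma pd_mxfun n f (A : 'M[C]_n) : pdmx A -> (forall x, 0 < x -> 0 < f x) ->
  pdmx (mxfun f A).
Proof.
move=> pA f0; have [] := @spectrum_lbound n (fun j => f (spectrum A j)).
  by move=> j; apply/f0/spectrum_gt0.
by move=> e e0 he; exists e => //; rewrite -(mxfun_cst e A); apply/loewner_mxfun.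
Qed.

Lemma eq_mxfun_psd n f g (A : 'M[C]_n) : psdmx A ->
  (forall x, 0 <= x -> f x = g x) -> mxfun f A = mxfun g A.
Proof. by move=> pA h; apply: eq_mxfun => j; apply/h/spectrum_ge0. Qed.

Lemma eq_mxfun_pd n f g (A : 'M[C]_n) : pdmx A ->
  (forall x, 0 < x -> f x = g x) -> mxfun f A = mxfun g A.
Proof. by move=> pA h; apply: eq_mxfun => j; apply/h/spectrum_gt0. Qed.

Lemma psd_mxfun_ge0 n f (A : 'M[C]_n) : psdmx A ->
  (forall x, 0 <= x -> 0 <= f x) -> psdmx (mxfun f A).
Proof. by move=> pA h; apply/psd_mxfun => j; apply/h/spectrum_ge0. Qed.

Lemma loewner_mxfun_psd n f g (A : 'M[C]_n) : psdmx A ->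
  (forall x, 0 <= x -> f x <= g x) -> loewner_le (mxfun f A) (mxfun g A).
Proof. by move=> pA h; apply/loewner_mxfun => j; apply/h/spectrum_ge0. Qed.

Lemma mxfun_scalar n f (a : R) : mxfun f (a%:C%:M : 'M[C]_n) = (f a)%:C%:M.
Proof. by rewrite -{1}(mxfun_cst a 0) mxfun_comp mxfun_cst. Qed.

Lemma mxfun_scale n f (a : R) (A : 'M[C]_n) : A ^t* = A ->
  mxfun f (a%:C *: A) = mxfun (fun x => f (a * x)) A.
Proof. by move=> hA; rewrite -{1}(mxfun_id hA) mxfunZ mxfun_comp. Qed.

Lemma mxpowD n (A : 'M[C]_n) s t : pdmx A ->
  mxpow A s *m mxpow A t = mxpow A (s + t).
Proof.
move=> pA; rewrite !mxpowE mxfunM; apply: eq_mxfun_pd => // x x0.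
by rewrite powRD// [x == 0]gt_eqF// implybT.
Qed.

Lemma mxpow0 n (A : 'M[C]_n) : mxpow A 0 = 1%:M.
Proof.
rewrite -[RHS](mxfun_cst 1 A) mxpowE; apply: eq_mxfun => j.
by rewrite powRr0.
Qed.

Lemma mxpow1 n (A : 'M[C]_n) : psdmx A -> mxpow A 1 = A.
Proof.
move=> pA; rewrite -[RHS](mxfun_id (psd_herm pA)) mxpowE.
by apply: eq_mxfun_psd => // x x0; rewrite powRr1.
Qed.

Lemma mxpow_herm n (A : 'M[C]_n) s : (mxpow A s) ^t* = mxpow A s.
Proof. by rewrite mxpowE mxfun_herm. Qed.

Lemma pd_mxpow n (A : 'M[C]_n) s : pdmx A -> pdmx (mxpow A s).
Proof. by move=> pA; rewrite mxpowE; apply: pd_mxfun => // x; apply: powR_gt0. Qed.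

Lemma psd_mxpow n (A : 'M[C]_n) s : psdmx (mxpow A s).
Proof. by rewrite mxpowE; apply/psd_mxfun => j; apply: powR_ge0. Qed.

Lemma mxpow_sqrtM n (A : 'M[C]_n) : pdmx A ->
  mxpow A 2^-1 *m mxpow A 2^-1 = A.
Proof.
by move=> pA; rewrite mxpowD// -div1r -splitr mxpow1//; apply: pd_psd.
Qed.

Lemma mxpowVr n (A : 'M[C]_n) s : pdmx A -> mxpow A s *m mxpow A (- s) = 1%:M.
Proof. by move=> pA; rewrite mxpowD// subrr mxpow0. Qed.

Lemma mxpowVl n (A : 'M[C]_n) s : pdmx A -> mxpow A (- s) *m mxpow A s = 1%:M.
Proof. by move=> pA; rewrite mxpowD// addNr mxpow0. Qed.

Lemma psd_conj n (S A : 'M[C]_n) : S ^t* = S -> psdmx A -> psdmx (S *m A *m S).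
Proof. by move=> hS pA; rewrite -{1}hS; apply: psd_congr. Qed.

Lemma loewner_conj n (S A B : 'M[C]_n) : S ^t* = S -> loewner_le A B ->
  loewner_le (S *m A *m S) (S *m B *m S).
Proof. by move=> hS AB; rewrite -{1 3}hS; apply: loewner_congr. Qed.

End LoewnerOrder.

(** * Hansen's inequality and monotonicity of the mean *)

Section Hansen.
Context {R : realType}.
Local Notation C := R[i].

(** On the range of [K^t*] the matrix [K^t* *m X *m K] acts as a copy of [X]; on the orthogonal
    complement it is 0 and contributes [f 0]. *)
Lemma mxfun_compression l k f (K : 'M[C]_(l, k)) (X : 'M[C]_l) :
  X ^t* = X -> K *m K ^t* = 1%:M ->
  mxfun f (K ^t* *m X *m K) =
  K ^t* *m mxfun f X *m K + (f 0)%:C *: (1%:M - K ^t* *m K).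
Proof.
move=> hX KK; set Y := K ^t* *m X *m K.
have hY : Y ^t* = Y by rewrite /Y !adj_mul trmxCK hX mulmxA.
have YK : Y *m K ^t* = K ^t* *m X by rewrite /Y -mulmxA KK mulmx1.
have fK := mxfun_intertwine f hY hX YK.
have Y0 : Y *m (1%:M - K ^t* *m K) = (1%:M - K ^t* *m K) *m (0 : R)%:C%:M.
  rewrite raddf0 mulmx0 mulmxBr mulmx1 mulmxA YK /Y.
  by rewrite subrr.
have f0 := mxfun_intertwine f hY (adj_scalar _ _) Y0.
rewrite mxfun_scalar mul_mx_scalar in f0.
by rewrite -f0 -fK mulmxBr mulmx1 !mulmxA addrC subrK.
Qed.

Lemma mxfun_block_diag k l f (P : 'M[C]_k) (Q : 'M[C]_l) :
  P ^t* = P -> Q ^t* = Q ->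
  (col_mx 1%:M 0) ^t* *m mxfun f (block_mx P 0 0 Q) *m col_mx 1%:M 0 = mxfun f P.
Proof.
move=> hP hQ; set T := block_mx P 0 0 Q.
have hT : T ^t* = T.
  by rewrite tr_block_mx map_block_mx hP hQ !trmx0 !map_mx0.
have TI : T *m col_mx 1%:M 0 = col_mx 1%:M 0 *m P.
  by rewrite mul_block_col mul_col_mx !mulmx1 !mulmx0 !mul0mx mul1mx !addr0.
rewrite -mulmxA (mxfun_intertwine f hT hP TI) mulmxA tr_col_mx map_row_mx.
by rewrite mul_row_col trmx0 map_mx0 mul0mx addr0 adj1 !mul1mx.
Qed.

Variable f : R -> R.
Hypothesis f_OM : OM_plus1 f.

Let f_ge0 x : 0 <= x -> 0 <= f x. Proof. by case: f_OM => h _ _; apply: h. Qed.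

Let f_mono k (A B : 'M[C]_k) : psdmx A -> psdmx B ->
  loewner_le A B -> loewner_le (mxfun f A) (mxfun f B).
Proof. by case: f_OM => _ h _; apply: h. Qed.

(* With [K = (C D)] a co-isometry, [K* X K] is dominated by the block diagonal
   matrix with blocks [(1+e) C*XC] and [(1+1/e) D*XD], the difference being
   [L* X L] for [L = (sqrt e C, - D / sqrt e)]; compare the top-left corners. *)
Lemma hansen_slack l k (X : 'M[C]_l) (Z : 'M[C]_(l, k)) (e : R) :
  psdmx X -> loewner_le (Z *m Z ^t*) 1%:M -> 0 < e ->
  loewner_le (Z ^t* *m mxfun f X *m Z)
             (mxfun f ((1 + e)%:C *: (Z ^t* *m X *m Z))).
Proof.
move=> pX cZ e0; have hX := psd_herm pX.
have pZ : psdmx (1%:M - Z *m Z ^t*) by rewrite -loewnerE.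
(* The defect operator of [Z], which completes [Z] to the co-isometry [K]. *)
pose D := mxpow (1%:M - Z *m Z ^t*) 2^-1.
have hD : D ^t* = D := mxpow_herm _ _.
have DD : D *m D = 1%:M - Z *m Z ^t*.
  rewrite /D mxpowE mxfunM -[RHS](mxfun_id (psd_herm pZ)).
  apply: eq_mxfun_psd => // x x0.
  by rewrite -expr2 -powR_mulrn ?powR_ge0// -powRrM mulVf ?powRr1 ?pnatr_eq0.
clearbody D.
pose K := row_mx Z D.
have KK : K *m K ^t* = 1%:M.
  by rewrite /K tr_row_mx map_col_mx mul_row_col hD DD addrC subrK.
pose I1 : 'M[C]_(k + l, k) := col_mx 1%:M 0.
have KI : K *m I1 = Z by rewrite /K /I1 mul_row_col mulmx1 mulmx0 addr0.
pose s := Num.sqrt e.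
have s0 : s != 0 by rewrite gt_eqF// sqrtr_gt0.
have ss : s * s = e by rewrite -expr2 sqr_sqrtr// ltW.
pose L := row_mx (s%:C *: Z) (- (s^-1)%:C *: D).
pose T := block_mx ((1 + e)%:C *: (Z ^t* *m X *m Z)) 0 0
                   ((1 + e^-1)%:C *: (D *m X *m D)).
have TE : T = K ^t* *m X *m K + L ^t* *m X *m L.
  rewrite /K /L !tr_row_mx !map_col_mx !(mul_col_mx _ _ X) !mul_col_row hD.
  rewrite add_block_mx -rmorphN !adj_scale hD -!scalemxAl -!scalemxAr !scalerA.
  rewrite -!rmorphM !mulrN !mulNr opprK mulfV// mulVf// -invfM ss.
  rewrite rmorphN rmorph1 !scaleN1r !subrr /T !rmorphD rmorph1.
  by rewrite !scalerDl !scale1r.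
have pK : psdmx (K ^t* *m X *m K) by apply: psd_congr.
have pL : psdmx (L ^t* *m X *m L) by apply: psd_congr.
have le : loewner_le (mxfun f (K ^t* *m X *m K)) (mxfun f T).
  have pT : psdmx T by rewrite TE; apply: psdD.
  apply: (f_mono pK pT).
  by rewrite loewnerE TE addrAC subrr add0r.
have hP : ((1 + e)%:C *: (Z ^t* *m X *m Z)) ^t* =
          (1 + e)%:C *: (Z ^t* *m X *m Z).
  by rewrite adj_scale !adj_mul trmxCK hX mulmxA.
have hQ : ((1 + e^-1)%:C *: (D *m X *m D)) ^t* = (1 + e^-1)%:C *: (D *m X *m D).
  by rewrite adj_scale !adj_mul hD hX mulmxA.
have : loewner_le (I1 ^t* *m mxfun f (K ^t* *m X *m K) *m I1)
    (mxfun f ((1 + e)%:C *: (Z ^t* *m X *m Z))).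
  by rewrite -(mxfun_block_diag f hP hQ); apply: loewner_congr.
apply: loewner_trans.
(* The top-left corner is [Z^t* *m mxfun f X *m Z] plus [f 0] times a corner of the projection
   [1 - K^t* *m K]; the extra term is positive since [f 0 >= 0]. *)
rewrite mxfun_compression// mulmxDr mulmxDl !mulmxA -!(mulmxA _ K I1) KI.
have -> : I1 ^t* *m K ^t* = Z ^t* by rewrite -adj_mul KI.
rewrite loewnerE addrAC subrr add0r; apply: psd_congr; apply: psdZ.
  exact: f_ge0.
have -> : 1%:M - K ^t* *m K = (1%:M - K ^t* *m K) ^t* *m (1%:M - K ^t* *m K).
  rewrite adj_sub adj1 adj_mul trmxCK !(mulmxBl, mulmxBr) !mulmx1 !mul1mx.
  by rewrite -[X in _ = _ - (_ - X)]mulmxA (mulmxA K) KK mul1mx subrr subr0.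
exact: psd_gram.
Qed.

(** The 1x1 case of [hansen_slack], with [Z = sqrt t]. *)
Lemma om_subhomogeneous_slack t x e : 0 <= t <= 1 -> 0 <= x -> 0 < e ->
  t * f x <= f ((1 + e) * (t * x)).
Proof.
move=> /andP[t0 t1] x0 e0; pose s := Num.sqrt t.
have ss : s * s = t by rewrite -expr2 sqr_sqrtr.
have := @hansen_slack 1 1 x%:C%:M s%:C%:M e (psd_scalar _ x0) _ e0.
rewrite !adj_scalar !mxfun_scalar -!scalar_mxM -!rmorphM ss.
rewrite scale_scalar_mx -rmorphM mxfun_scalar mulrAC ss mulrAC ss.
move=> h; apply: (@loewner_scalarP _ 0); apply: h.
exact: (loewner_scalar _ t1).
Qed.

(** In the inequality with slack at the point [s x], the choice [t = (s (1 + e))^-1] collapses the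
    argument of [f] to [x]; then [e] tends to 0. *)
Lemma om_superhomogeneous s x : 1 <= s -> 0 <= x -> f (s * x) <= s * f x.
Proof.
move=> s1 x0; have s0 : 0 < s := lt_le_trans ltr01 s1.
have fx := f_ge0 x0.
apply/ler_addgt0Pr => d d0.
(* Chosen so that the error [e * (s * f x)] is at most [d]. *)
pose e := d / (s * f x + 1).
have p0 : 0 < s * f x + 1 by rewrite ltr_wpDl// mulr_ge0// ltW.
have e0 : 0 < e by rewrite divr_gt0.
have se0 : 0 < s * (1 + e) by rewrite mulr_gt0// addr_gt0.
have t01 : 0 <= (s * (1 + e))^-1 <= 1.
  by rewrite invr_ge0 ltW//= invf_le1// mulr_ege1// lerDl ltW.
have := om_subhomogeneous_slack t01 (mulr_ge0 (ltW s0) x0) e0.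
have -> : (1 + e) * ((s * (1 + e))^-1 * (s * x)) = x.
  by field; rewrite !gt_eqF// addr_gt0.
rewrite mulrC ler_pdivrMr// => /le_trans -> //.
have -> : f x * (s * (1 + e)) = s * f x + e * (s * f x) by ring.
rewrite lerD2l /e -mulrA ger_pMr// mulrC ler_pdivrMr ?mul1r ?lerDl//.
Qed.

(** Below 1, scaling by [x^-1] gives [1 = f 1 <= x^-1 * f x]. Strict positivity is what allows
    division by [f] in the Ando-Hiai argument. *)
Lemma om_gt0 x : 0 < x -> 0 < f x.
Proof.
move=> x0; have f1 : f 1 = 1 by case: f_OM.
have [x1|x1] := leP 1 x.
  apply: (@lt_le_trans _ _ 1) => //; rewrite -f1.
  have := @f_mono 1 1%:C%:M x%:C%:M (psd_scalar _ ler01) (psd_scalar _ (ltW x0)).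
  rewrite !mxfun_scalar => h; apply: (@loewner_scalarP _ 0); apply: h.
  exact: loewner_scalar.
have := @om_superhomogeneous x^-1 x.
rewrite invf_ge1// (ltW x1) mulVf ?gt_eqF// f1 => /(_ isT (ltW x0)) h.
have : 0 < x^-1 * f x by apply: lt_le_trans h.
by rewrite pmulr_rgt0// invr_gt0.
Qed.

(** The slack is absorbed by [f ((1 + e) x) <= (1 + e) f x], which leaves an error of [e] times a
    fixed matrix. *)
Lemma hansen l k (X : 'M[C]_l) (Z : 'M[C]_(l, k)) :
  psdmx X -> loewner_le (Z *m Z ^t*) 1%:M ->
  loewner_le (Z ^t* *m mxfun f X *m Z) (mxfun f (Z ^t* *m X *m Z)).
Proof.
move=> pX cZ; have pY := psd_congr Z pX.
apply: (@loewner_closed _ _ _ _ (mxfun f (Z ^t* *m X *m Z))).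
- by rewrite adj_congr mxfun_herm.
- exact: mxfun_herm.
- exact: psd_mxfun_ge0.
move=> e e0; apply: loewner_trans (hansen_slack pX cZ e0) _.
rewrite (mxfun_scale f (1 + e) (psd_herm pY)) mxfunZ mxfunD.
apply: loewner_mxfun_psd => // x x0.
rewrite -{1}[f x]mul1r -mulrDl; apply: om_superhomogeneous => //.
by rewrite lerDl ltW.
Qed.

(** [A1 <= A2] says that [Z = A1^(1/2) A2^(-1/2)] is a contraction. Hansen's inequality for this [Z]
    and [A1^(-1/2) B1 A1^(-1/2)] replaces the normalisation by [A1] with that by [A2]; the change
    from [B1] to [B2] is then plain operator monotonicity. *)
Lemma opmean_pos_monotone l (A1 A2 B1 B2 : 'M[C]_l) :
  pdmx A1 -> loewner_le A1 A2 -> psdmx B1 -> loewner_le B1 B2 ->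
  loewner_le (opmean_pos f A1 B1) (opmean_pos f A2 B2).
Proof.
move=> pA1 lA pB1 lB; have pA2 := pd_le pA1 lA.
have pB2 := loewner_psd pB1 lB.
rewrite /opmean_pos.
set T := mxpow A1 2^-1; set T' := mxpow A1 (- 2^-1).
set S := mxpow A2 2^-1; set S' := mxpow A2 (- 2^-1).
have hT : T ^t* = T := mxpow_herm _ _; have hT' : T' ^t* = T' := mxpow_herm _ _.
have hS : S ^t* = S := mxpow_herm _ _; have hS' : S' ^t* = S' := mxpow_herm _ _.
have TT' : T *m T' = 1%:M := mxpowVr _ pA1.
have T'T : T' *m T = 1%:M := mxpowVl _ pA1.
have SS' : S *m S' = 1%:M := mxpowVr _ pA2.
have S'S : S' *m S = 1%:M := mxpowVl _ pA2.
have TT : T *m T = A1 := mxpow_sqrtM pA1.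
have SS : S *m S = A2 := mxpow_sqrtM pA2.
clearbody S S' T T'.
have cZ : loewner_le ((T *m S') *m (T *m S') ^t*) 1%:M.
  apply: contraction_adj.
  have := loewner_conj hS' lA.
  by rewrite -TT -SS adj_mul hT hS' !mulmxA S'S mul1mx SS'.
have pY : psdmx (T' *m B1 *m T') by apply: psd_conj.
have := hansen pY cZ; rewrite adj_mul hT hS'.
have -> : S' *m T *m (T' *m B1 *m T') *m (T *m S') = S' *m B1 *m S'.
  rewrite !mulmxA -(mulmxA S' T T') TT' mulmx1.
  by rewrite -(mulmxA _ T' T) T'T mulmx1.
have lS : loewner_le (S' *m B1 *m S') (S' *m B2 *m S') by apply: loewner_conj.
have lf := f_mono (psd_conj hS' pB1) (psd_conj hS' pB2) lS.
move=> h; have := loewner_conj hS (loewner_trans h lf).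
rewrite !mulmxA SS' mul1mx -(mulmxA _ S' S) S'S mulmx1.
by [].
Qed.

Lemma psd_opmean_pos l (A B : 'M[C]_l) : psdmx B -> psdmx (opmean_pos f A B).
Proof.
move=> pB; apply: psd_conj; first exact: mxpow_herm.
apply: (psd_mxfun_ge0 _ f_ge0); apply: psd_conj; [exact: mxpow_herm | exact: pB].
Qed.

End Hansen.

(** * The Loewner-Heinz and Jensen inequalities *)

Section LoewnerHeinz.
Context {R : realType}.
Local Notation C := R[i].

Lemma qform_congr m n (Z : 'M[C]_(m, n)) (A : 'M[C]_m) v :
  qform (Z ^t* *m A *m Z) v = qform A (Z *m v).
Proof. by rewrite /qform adj_mul !mulmxA. Qed.

Lemma qform_scalev n (a : R) (A : 'M[C]_n) v :
  qform A (a%:C *: v) = a ^+ 2 * qform A v.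
Proof.
rewrite -qformZ /qform adj_scale -!scalemxAl -!scalemxAr -scalemxAl scalerA.
by rewrite -rmorphM expr2.
Qed.

(** [S] carries an eigenvector [w] of [H] to an eigenvector [S w] of the contraction [M] with the
    same eigenvalue, which is thus at most 1; positivity of [S^t* *m S] gives [S w != 0]. *)
Lemma contraction_similar n (H M S : 'M[C]_n) :
  psdmx H -> pdmx (S ^t* *m S) -> M *m S = S *m H ->
  loewner_le (M ^t* *m M) 1%:M -> loewner_le H 1%:M.
Proof.
move=> pH pS MS cM; have hH := psd_herm pH.
apply/(spectrum_le 1 hH) => j.
pose w := (spectralmx H) ^t* *m delta_mx j (0 : 'I_1).
have Hw : H *m w = (spectrum H j)%:C *: w.
  rewrite /w mulmxA (spectral_mulr hH) -mulmxA scalemxAr; congr (_ *m _).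
  apply/matrixP => k l; rewrite /rdiag mul_diag_mx !mxE.
  by have [->|] := eqVneq k j; rewrite ?mulr0.
have w1 : qform 1%:M w = 1.
  rewrite /qform mulmx1 /w adj_mul trmxCK -mulmxA (mulmxA (spectralmx H)).
  rewrite spectral_Madj mul1mx mxE (bigD1 j)//= big1 => [|k /negPf kj].
    by rewrite !mxE !eqxx rmorph1 mul1r addr0.
  by rewrite !mxE kj mulr0.
have Gw : 0 < qform (S ^t* *m S) w.
  have hS := psd_herm (pd_psd pS).
  case: pS => e e0 /(loewnerP (adj_scalar _ _) hS) /(_ w); apply: lt_le_trans.
  by rewrite -scalemx1 qformZ w1 mulr1.
have h1 : (M ^t* *m M) ^t* = M ^t* *m M by rewrite adj_mul trmxCK.
have := loewner_congr S cM.
have -> : S ^t* *m (M ^t* *m M) *m S = H ^t* *m (S ^t* *m S) *m H.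
  by rewrite -!mulmxA MS !mulmxA -!adj_mul MS.
have hL : (H ^t* *m (S ^t* *m S) *m H) ^t* = H ^t* *m (S ^t* *m S) *m H.
  by rewrite adj_congr (adj_mul _ S) trmxCK.
have hR : (S ^t* *m 1%:M *m S) ^t* = S ^t* *m 1%:M *m S.
  by rewrite adj_congr adj1.
move=> /(loewnerP hL hR) /(_ w); rewrite qform_congr Hw qform_scalev mulmx1.
rewrite ger_pMl// => h2; have h0 := spectrum_ge0 j pH.
by rewrite -(ler_pXn2r (n := 2))// ?nnegrE// expr1n.
Qed.

Lemma contraction_mul m n p (M : 'M[C]_(m, n)) (N : 'M[C]_(n, p)) :
  loewner_le (M ^t* *m M) 1%:M -> loewner_le (N ^t* *m N) 1%:M ->
  loewner_le ((M *m N) ^t* *m (M *m N)) 1%:M.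
Proof.
move=> cM; apply: loewner_trans; have := loewner_congr N cM.
by rewrite adj_mul mulmx1 !mulmxA.
Qed.

Lemma contraction_of_le n (P Q A B : 'M[C]_n) : P ^t* = P -> Q ^t* = Q ->
  P *m P = A -> Q *m B *m Q = 1%:M -> loewner_le A B ->
  loewner_le ((P *m Q) ^t* *m (P *m Q)) 1%:M.
Proof.
move=> hP hQ PP QBQ le; rewrite -QBQ adj_mul hP hQ.
by have := loewner_conj hQ le; rewrite -PP !mulmxA.
Qed.

Lemma mxpow_le_contraction n (X Y : 'M[C]_n) s : pdmx X -> pdmx Y ->
  loewner_le (mxpow X s) (mxpow Y s) ->
  loewner_le ((mxpow X (s / 2) *m mxpow Y (- (s / 2))) ^t*
               *m (mxpow X (s / 2) *m mxpow Y (- (s / 2)))) 1%:M.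
Proof.
move=> pX pY; apply: contraction_of_le; [exact: mxpow_herm | exact: mxpow_herm | |].
  by rewrite (mxpowD _ _ pX) -splitr.
rewrite (mxpowD _ _ pY) (mxpowD _ _ pY).
have -> : - (s / 2) + s = s / 2 by rewrite {2}(splitr s) addKr.
by rewrite subrr mxpow0.
Qed.

Lemma mulmx_regroup n (A B D E S T F : 'M[C]_n) :
  B *m D = F -> E *m S = T -> S *m T = A ->
  A *m B *m (D *m E) *m S = S *m (T *m F *m T).
Proof.
by move=> BD ES ST; rewrite !mulmxA ST -(mulmxA A) BD -(mulmxA _ E) ES.
Qed.

(** With [q = (s + t) / 2], the product [Y^(-t/2) X^q Y^(-s/2)] of two contractions is a
    contraction, and [S = Y^((q-t)/2)] makes it similar to the positive matrix
    [H = Y^(-q/2) X^q Y^(-q/2)]. Hence [H <= 1], which is the claim conjugated by [Y^(-q/2)]. *)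
Lemma mxpow_le_mid n (X Y : 'M[C]_n) s t : pdmx X -> pdmx Y ->
  loewner_le (mxpow X s) (mxpow Y s) -> loewner_le (mxpow X t) (mxpow Y t) ->
  loewner_le (mxpow X ((s + t) / 2)) (mxpow Y ((s + t) / 2)).
Proof.
move=> pX pY les le_t; pose q := (s + t) / 2; rewrite -/q.
have cs := mxpow_le_contraction pX pY les.
have ct := mxpow_le_contraction pX pY le_t.
set N1 := mxpow X (t / 2) *m mxpow Y (- (t / 2)) in ct.
set N2 := mxpow X (s / 2) *m mxpow Y (- (s / 2)) in cs.
have cM : loewner_le ((N1 ^t* *m N2) ^t* *m (N1 ^t* *m N2)) 1%:M.
  by apply: contraction_mul cs; rewrite trmxCK; apply: contraction_adj.
pose T := mxpow Y (- (q / 2)).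
pose H := T *m mxpow X q *m T.
pose S := mxpow Y ((q - t) / 2).
have hS : S ^t* = S := mxpow_herm _ _.
have pH : psdmx H by apply: psd_conj; [exact: mxpow_herm | exact: psd_mxpow].
have pS : pdmx (S ^t* *m S).
  by rewrite hS (mxpowD _ _ pY); apply: pd_mxpow.
have NS : N1 ^t* *m N2 *m S = S *m H.
  have -> : N1 ^t* = mxpow Y (- (t / 2)) *m mxpow X (t / 2).
    by rewrite adj_mul; congr (_ *m _); apply: mxpow_herm.
  have e1 : mxpow X (t / 2) *m mxpow X (s / 2) = mxpow X q.
    by rewrite (mxpowD (t / 2) (s / 2) pX) -mulrDl [t + s]addrC.
  have e2 : mxpow Y (- (s / 2)) *m S = T.
    by rewrite (mxpowD _ _ pY); congr (mxpow _ _); rewrite /q; field.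
  have e3 : S *m T = mxpow Y (- (t / 2)).
    by rewrite (mxpowD _ _ pY); congr (mxpow _ _); rewrite /q; field.
  exact (mulmx_regroup e1 e2 e3).
have := loewner_conj (mxpow_herm Y (q / 2)) (contraction_similar pH pS NS cM).
have e4 : mxpow Y (q / 2) *m T = 1%:M := mxpowVr _ pY.
have e5 : T *m mxpow Y (q / 2) = 1%:M := mxpowVl _ pY.
rewrite mulmx1 (mxpowD _ _ pY) -splitr /H.
move: (mxpow X q) (mxpow Y (q / 2)) T e4 e5 {H S hS pH pS NS} => B C D e4 e5.
by rewrite !mulmxA e4 mul1mx -mulmxA e5 mulmx1.
Qed.

Lemma bisection (P : R -> Prop) s n : P 0 -> P 1 ->
  (forall a b, P a -> P b -> P ((a + b) / 2)) -> 0 <= s <= 1 ->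
  exists a b, [/\ P a, P b, a <= s <= b & b - a = 2^-1 ^+ n].
Proof.
move=> P0 P1 Pm s01; elim: n => [|n [a [b [Pa Pb /andP[as_ sb] ab]]]].
  by exists 0, 1; rewrite subr0 expr0.
have Pc := Pm _ _ Pa Pb.
have [sc|cs] := leP s ((a + b) / 2).
  exists a, ((a + b) / 2); split; rewrite ?as_//.
  by rewrite exprS -ab; field.
exists ((a + b) / 2), b; split; rewrite ?sb ?ltW//.
by rewrite exprS -ab; field.
Qed.

Lemma loewner_mxfun_slack n f g (A : 'M[C]_n) (e : R) :
  (forall j, f (spectrum A j) <= g (spectrum A j) + e) ->
  loewner_le (mxfun f A) (mxfun g A + e%:C%:M).
Proof. by move=> h; rewrite -(mxfun_cst e A) mxfunD; apply/loewner_mxfun. Qed.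

Lemma mxpow_continuous_exp n (X : 'M[C]_n) (s e : R) : pdmx X -> 0 < e ->
  exists2 d : R, 0 < d & forall t, `|s - t| < d ->
    loewner_le (mxpow X s) (mxpow X t + e%:C%:M) /\
    loewner_le (mxpow X t) (mxpow X s + e%:C%:M).
Proof.
move=> pX e0.
have : \forall t \near s, forall j, `|spectrum X j `^ s - spectrum X j `^ t| < e.
  apply: (@filter_forall R 'I_n
    (fun j t => `|spectrum X j `^ s - spectrum X j `^ t| < e) (nbhs s)) => j.
  have x0 := spectrum_gt0 j pX.
  have cx : {for s, continuous (fun t : R => expR (t * ln (spectrum X j)))}.
    apply: continuous_comp; last exact: continuous_expR.
    by apply: cvgM; [exact: cvg_id | exact: cvg_cst].
  have := cx; move=> /cvgrPdist_lt /(_ e e0).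
  apply: filterS => t; rewrite /powR gt_eqF//.
move=> /nbhs_ballP[d /= d0 hd]; exists d => // t st.
have {}hd j : `|spectrum X j `^ s - spectrum X j `^ t| < e by apply: hd.
rewrite (mxpowE X s) (mxpowE X t).
by split; apply: loewner_mxfun_slack => j; have := hd j; rewrite ltr_distl;
  move=> /andP[h1 h2]; lra.
Qed.

(** The admissible exponents contain 0 and 1 and are closed under midpoints; continuity of [X^t] and
    [Y^t] in the exponent does the rest, at a cost of [e / 2] for each matrix. *)
Lemma loewner_heinz_pd n (X Y : 'M[C]_n) s : pdmx X -> loewner_le X Y ->
  0 <= s <= 1 -> loewner_le (mxpow X s) (mxpow Y s).
Proof.
move=> pX le s01; have pY := pd_le pX le.
pose P t := loewner_le (mxpow X t) (mxpow Y t).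
have P0 : P 0 by rewrite /P !mxpow0; apply: loewner_refl.
have P1 : P 1 by rewrite /P (mxpow1 (pd_psd pX)) (mxpow1 (pd_psd pY)); exact: le.
apply: (@loewner_closed _ _ _ _ 1%:M);
  [exact: mxpow_herm | exact: mxpow_herm | exact: psd1 | move=> e e0].
have e2 : 0 < e / 2 by rewrite divr_gt0.
have [d1 d10 h1] := mxpow_continuous_exp s pX e2.
have [d2 d20 h2] := mxpow_continuous_exp s pY e2.
pose d := Num.min d1 d2.
have d0 : 0 < d by rewrite lt_min d10.
(* This gives [2^-N < d], because [d^-1 < N < 2^N]. *)
pose N := Num.bound d^-1.
have [a [b [Pa _ /andP[as_ sb] ab]]] :=
  @bisection P s N P0 P1 (fun a b => @mxpow_le_mid n X Y a b pX pY) s01.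
have sa : `|s - a| < d.
  rewrite ger0_norm ?subr_ge0//; apply: (@le_lt_trans _ _ (b - a)).
    by rewrite lerD2r.
  rewrite ab exprVn invf_plt ?posrE ?exprn_gt0//.
  apply: lt_trans (archi_boundP _) _; first by rewrite invr_ge0 ltW.
  by rewrite -natrX ltr_nat ltn_expl.
move: sa; rewrite lt_min => /andP[/h1[l1 _] /h2[_ l2]].
apply: loewner_trans l1 _; rewrite scalemx1 {2}(splitr e) rmorphD raddfD /= addrA.
apply: loewner_add; last exact: loewner_refl.
exact: loewner_trans Pa l2.
Qed.

Lemma mxpow_shift n (Y : 'M[C]_n) (d s : R) : Y ^t* = Y ->
  mxpow (Y + d%:C%:M) s = mxfun (fun x => (x + d) `^ s) Y.
Proof.
by move=> hY; rewrite -{1}(mxfun_id hY) -(mxfun_cst d Y) mxfunD mxpowE mxfun_comp.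
Qed.

Lemma mxpow_right_continuous n (Y : 'M[C]_n) (s e : R) :
  psdmx Y -> 0 < s -> 0 < e ->
  exists2 d0 : R, 0 < d0 & forall d, 0 <= d <= d0 ->
    loewner_le (mxpow (Y + d%:C%:M) s) (mxpow Y s + e%:C%:M).
Proof.
move=> pY s0 e0.
(* [(y^s + e)^(1/s) - y] is the exact increment of [y] at which [y^s] has grown by [e]. *)
have [] := @spectrum_lbound R n
  (fun j => (spectrum Y j `^ s + e) `^ s^-1 - spectrum Y j).
  move=> j; rewrite subr_gt0; have y0 := spectrum_ge0 j pY.
  rewrite -{1}(powRr1 y0) -(mulfV (lt0r_neq0 s0)) powRrM.
  by rewrite gt0_ltr_powR ?invr_gt0 ?nnegrE ?addr_ge0 ?powR_ge0 ?ltW// ltrDl.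
move=> d0 d00 hd; exists d0; first exact: d00.
move=> d /andP[d_ge0 dd0].
rewrite (mxpow_shift d s (psd_herm pY)) (mxpowE Y s).
apply: loewner_mxfun_slack => j; have y0 := spectrum_ge0 j pY.
have z0 : 0 <= spectrum Y j `^ s + e by rewrite addr_ge0 ?powR_ge0// ltW.
rewrite -[leRHS]powRr1// -(mulVf (lt0r_neq0 s0)) powRrM.
apply: (ge0_ler_powR (ltW s0)); rewrite ?nnegrE ?addr_ge0 ?powR_ge0//.
by have := hd j; lra.
Qed.

(** Both matrices are shifted by [d]. Only the return from [Y + d] to [Y] needs continuity, since
    [X^s <= (X + d)^s]. *)
Lemma loewner_heinz n (X Y : 'M[C]_n) s : psdmx X -> loewner_le X Y ->
  0 <= s <= 1 -> loewner_le (mxpow X s) (mxpow Y s).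
Proof.
move=> pX le s01; have pY := loewner_psd pX le.
case/andP: (s01) => s0 s1; have [->|sn0] := eqVneq s 0.
  by rewrite !mxpow0; apply: loewner_refl.
have sp : 0 < s by rewrite lt_neqAle eq_sym sn0.
apply: (@loewner_closed _ _ _ _ 1%:M);
  [exact: mxpow_herm | exact: mxpow_herm | exact: psd1 | move=> e e0].
rewrite scalemx1; have [d d0 hd] := mxpow_right_continuous pY sp e0.
have dd : 0 <= d <= d by rewrite lexx ltW.
apply: (loewner_trans _ (hd d dd)).
apply: (@loewner_trans _ _ (mxpow (X + d%:C%:M) s)).
  rewrite (mxpow_shift d s (psd_herm pX)) (mxpowE X s).
  apply: loewner_mxfun_psd => // x x0.
  have dge0 := ltW d0.
  by apply: (ge0_ler_powR s0); rewrite ?nnegrE ?addr_ge0 ?lerDl.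
apply: (loewner_heinz_pd (psd_pdD pX d0) _ s01).
by apply: (loewner_add le); apply: loewner_refl.
Qed.

Lemma psd_gramr m n (Z : 'M[C]_(m, n)) : psdmx (Z *m Z ^t*).
Proof. by have := psd_gram (Z ^t*); rewrite trmxCK. Qed.

(** [Z] intertwines [Z Z'] and [Z' Z], where [Z'] is the adjoint. The identity trades the power
    [1 + s] for the power [s], which is within reach of Loewner-Heinz. *)
Lemma mxpow_gram m n (Z : 'M[C]_(m, n)) s : 0 <= s ->
  mxpow (Z ^t* *m Z) (1 + s) = Z ^t* *m mxpow (Z *m Z ^t*) s *m Z.
Proof.
move=> s0; have pZ := psd_gram Z; have hZ := psd_herm pZ.
have hZ' : (Z *m Z ^t*) ^t* = Z *m Z ^t* by rewrite adj_mul trmxCK.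
have E : Z *m Z ^t* *m Z = Z *m (Z ^t* *m Z) by rewrite mulmxA.
rewrite (mxpowE (Z *m _)) (mxpowE (_ *m Z)) -mulmxA.
rewrite (mxfun_intertwine _ hZ' hZ E) mulmxA -{2}(mxfun_id hZ) mxfunM.
apply: eq_mxfun_psd => // x x0.
by rewrite powRD ?powRr1// gt_eqF// ltr_wpDr.
Qed.

(** With [Y = X^(1/2) Z] and adjoint [Y'], the left side is [(Y' Y)^(1+s) = Y' (Y Y')^s Y]. Since
    [Z] is a contraction, [Y Y' <= X], and Loewner-Heinz bounds [(Y Y')^s] by [X^s]. *)
Lemma jensen_mxpow m n (X : 'M[C]_m) (Z : 'M[C]_(m, n)) s :
  psdmx X -> loewner_le (Z *m Z ^t*) 1%:M -> 0 <= s <= 1 ->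
  loewner_le (mxpow (Z ^t* *m X *m Z) (1 + s)) (Z ^t* *m mxpow X (1 + s) *m Z).
Proof.
move=> pX cZ s01; have [s0 _] := andP s01.
pose S := mxpow X 2^-1; have hS : S ^t* = S := mxpow_herm _ _.
have SS : S *m S = X.
  rewrite /S mxpowE mxfunM -[RHS](mxfun_id (psd_herm pX)).
  apply: eq_mxfun_psd => // x x0.
  by rewrite -expr2 -powR_mulrn ?powR_ge0// -powRrM mulVf ?powRr1 ?pnatr_eq0.
have SXS : S *m mxpow X s *m S = mxpow X (1 + s).
  rewrite /S !mxpowE !mxfunM; apply: eq_mxfun_psd => // x x0.
  rewrite mulrAC -expr2 -powR_mulrn ?powR_ge0// -powRrM mulVf ?pnatr_eq0//.
  by rewrite powRD// gt_eqF// ltr_wpDr.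
have lS : loewner_le ((S *m Z) *m (S *m Z) ^t*) X.
  have := loewner_conj hS cZ.
  by rewrite mulmx1 SS adj_mul hS !mulmxA.
have le := loewner_heinz (psd_gramr (S *m Z)) lS s01.
have : loewner_le (mxpow ((S *m Z) ^t* *m (S *m Z)) (1 + s))
                  ((S *m Z) ^t* *m mxpow X s *m (S *m Z)).
  by rewrite (mxpow_gram (S *m Z) s0); apply: loewner_congr.
move: (mxpow X s) (mxpow X (1 + s)) SXS => Xs Xs1 <-.
clearbody S; rewrite -SS adj_mul hS => h.
by rewrite !mulmxA in h *.
Qed.

End LoewnerHeinz.

(** * Positive maps and the Ando-Hiai inequality *)

Section PositiveMaps.
Context {R : realType}.
Local Notation C := R[i].

(** Indexed by positions rather than by distinct eigenvalues: each is a projection of rank one, and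
    a repeated eigenvalue has several. *)
Definition eigenproj n (A : 'M[C]_n) (j : 'I_n) : 'M[C]_n :=
  (spectralmx A) ^t* *m rdiag (fun k => (k == j)%:R) *m spectralmx A.

Lemma psd_eigenproj n (A : 'M[C]_n) j : psdmx (eigenproj A j).
Proof. by apply: psd_congr; apply/psd_rdiag => k; apply: ler0n. Qed.

Lemma mxfun_eigenproj n f (A : 'M[C]_n) :
  mxfun f A = \sum_j (f (spectrum A j))%:C *: eigenproj A j.
Proof.
rewrite mxfunE.
have -> : rdiag (fun j => f (spectrum A j)) =
    \sum_j (f (spectrum A j))%:C *: rdiag (fun k => (k == j)%:R).
  apply/matrixP => i k; rewrite summxE /rdiag.
  rewrite (bigD1 i)//= big1 => [|j /negPf ji]; last first.
    by rewrite !mxE eq_sym ji mul0rn mulr0.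
  by rewrite !mxE eqxx addr0 mulrnAr rmorph1 mulr1.
rewrite mulmx_sumr mulmx_suml; apply: eq_bigr => j _.
by rewrite -scalemxAr -scalemxAl.
Qed.

Lemma mxdiag_scalar n l (a : 'I_n -> R) :
  \mxdiag_(j < n) ((a j)%:C%:M : 'M[C]_l) =
  rdiag (fun k => a (tagnat.sig1 k)).
Proof.
have -> : \mxdiag_(j < n) ((a j)%:C%:M : 'M[C]_l) =
          \mxdiag_(j < n) diag_mx (const_mx (a j)%:C : 'rV_l).
  by apply: eq_mxdiag => j; rewrite diag_const_mx.
rewrite -diag_mxrow /rdiag; congr diag_mx.
by apply/rowP => k; rewrite !mxE.
Qed.

Lemma mxcol_congr n l (a : 'I_n -> R) (Z : 'I_n -> 'M[C]_l) :
  (\mxcol_j Z j) ^t* *m \mxdiag_j ((a j)%:C%:M) *m \mxcol_j Z j =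
  \sum_j (a j)%:C *: ((Z j) ^t* *m Z j).
Proof.
have -> : (\mxcol_j Z j) ^t* = \mxrow_j (Z j) ^t*.
  by apply/matrixP => i k; rewrite !mxE.
rewrite mul_mxrow_mxdiag mul_mxrow_mxcol.
by apply: eq_bigr => j _; rewrite mul_mx_scalar -scalemxAl.
Qed.

Lemma mxpow_scale n (t s : R) (A : 'M[C]_n) : 0 <= t -> psdmx A ->
  mxpow (t%:C *: A) s = (t `^ s)%:C *: mxpow A s.
Proof.
move=> t0 pA; rewrite (mxpowE (_ *: _)) (mxpowE A).
rewrite (mxfun_scale _ _ (psd_herm pA)) mxfunZ.
by apply: eq_mxfun_psd => // x x0; rewrite powRM.
Qed.

(* Restricted to the spectral projections of [A] the map is a compression:
   [Phi (f A) = c Z* f(X) Z], where [Z] stacks the [sqrt (Phi P_j / c)] and [X]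
   is block diagonal with blocks [a_j I]. *)
Lemma positive_map_mxpow n l (Phi : {linear 'M[C]_n -> 'M[C]_l})
    (A : 'M[C]_n) (c s : R) :
  positive_map Phi -> psdmx A -> 0 < c -> loewner_le (Phi 1%:M) c%:C%:M ->
  0 <= s <= 1 ->
  loewner_le (mxpow (Phi A) (1 + s)) ((c `^ s)%:C *: Phi (mxpow A (1 + s))).
Proof.
move=> pPhi pA c0 leP s01.
pose E j := Phi (eigenproj A j).
have pE j : psdmx (E j) by apply: pPhi; apply: psd_eigenproj.
have PhiE f : Phi (mxfun f A) = \sum_j (f (spectrum A j))%:C *: E j.
  by rewrite mxfun_eigenproj linear_sum; apply: eq_bigr => j _; rewrite linearZ.
pose Z j := mxpow ((c^-1)%:C *: E j) 2^-1.
have cV0 : 0 <= c^-1 by rewrite invr_ge0 ltW.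
have ZZ j : (Z j) ^t* *m Z j = (c^-1)%:C *: E j.
  have pcE := psdZ cV0 (pE j).
  rewrite [X in X *m _](mxpow_herm _ 2^-1) /Z mxpowE mxfunM.
  rewrite -[RHS](mxfun_id (psd_herm pcE)); apply: eq_mxfun_psd => // x x0.
  by rewrite -expr2 -powR_mulrn ?powR_ge0// -powRrM mulVf ?powRr1 ?pnatr_eq0.
pose W := \mxcol_j Z j.
have WW (a : 'I_n -> R) : W ^t* *m \mxdiag_j ((a j)%:C%:M) *m W =
    (c^-1)%:C *: \sum_j (a j)%:C *: E j.
  rewrite mxcol_congr scaler_sumr; apply: eq_bigr => j _.
  by rewrite ZZ scalerA mulrC -scalerA.
(* [W^t* *m W] is [c^-1] times [Phi 1%:M], hence at most the identity. *)
have cW : loewner_le (W *m W ^t*) 1%:M.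
  apply: contraction_adj.
  have := WW (fun=> 1); rewrite -(PhiE (fun=> 1)) mxfun_cst mxdiagZ mulmx1 => ->.
  have -> : (1%:M : 'M[C]_l) = (c^-1)%:C *: c%:C%:M.
    by rewrite scale_scalar_mx -rmorphM mulVf// gt_eqF.
  exact: loewner_scale.
have pX : psdmx (\mxdiag_(j < n) ((spectrum A j)%:C%:M : 'M[C]_l)).
  by rewrite mxdiag_scalar; apply/psd_rdiag => k; apply: spectrum_ge0.
have := jensen_mxpow pX cW s01.
have -> : mxpow (\mxdiag_(j < n) ((spectrum A j)%:C%:M : 'M[C]_l)) (1 + s) =
          \mxdiag_(j < n) ((spectrum A j `^ (1 + s))%:C%:M).
  by rewrite !mxdiag_scalar mxpowE mxfun_rdiag.
rewrite (WW (spectrum A)) (WW (fun j => spectrum A j `^ (1 + s))).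
rewrite -(PhiE id) -(PhiE (fun x => x `^ (1 + s))) -mxpowE.
rewrite (mxfun_id (psd_herm pA)) => h.
have [s0 s1] := andP s01; have s_ge0 : 0 <= 1 + s by rewrite addr_ge0.
(* The factor [c^(1+s)] cancels the [c^-1] inside the power on the left and turns the outer [c^-1]
   on the right into [c^s]. *)
have := loewner_scale (powR_ge0 c (1 + s)) h.
have cs : c `^ (1 + s) * c^-1 = c `^ s.
  rewrite powRD; last by rewrite [c == 0]gt_eqF// implybT.
  by rewrite (powRr1 (ltW c0)) mulrAC mulfV ?mul1r// gt_eqF.
rewrite scalerA -rmorphM cs.
suff -> : (c `^ (1 + s))%:C *: mxpow ((c^-1)%:C *: Phi A) (1 + s) =
          mxpow (Phi A) (1 + s) by [].
rewrite (mxpow_scale _ cV0 (pPhi _ pA)) scalerA -rmorphM -powRM ?(ltW c0)//.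
by rewrite mulfV ?gt_eqF// powR1 scale1r.
Qed.

End PositiveMaps.

(** * The Ando-Hiai inequality for positive definite matrices *)

Section AndoHiai.
Context {R : realType}.
Local Notation C := R[i].

Lemma mxpow_comp n (A : 'M[C]_n) s t :
  mxpow (mxpow A s) t = mxpow A (s * t).
Proof.
rewrite (mxpowE (mxpow A s)) (mxpowE A s) mxfun_comp (mxpowE A).
by apply: eq_mxfun => j /=; rewrite powRrM.
Qed.

(** [X <= Y] makes [X^(1/2) Y^(-1/2)] a contraction; its adjoint is then one too, which reads
    [X^(1/2) Y^(-1) X^(1/2) <= 1]. *)
Lemma loewner_inv n (X Y : 'M[C]_n) : pdmx X -> loewner_le X Y ->
  loewner_le (mxpow Y (- 1)) (mxpow X (- 1)).
Proof.
move=> pX le; have pY := pd_le pX le.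
have le1 : loewner_le (mxpow X 1) (mxpow Y 1).
  by rewrite (mxpow1 (pd_psd pX)) (mxpow1 (pd_psd pY)); exact: le.
have := contraction_adj (mxpow_le_contraction pX pY le1).
move/(loewner_conj (mxpow_herm X (- (1 / 2)))).
have e1 : mxpow X (- (1 / 2)) *m mxpow X (1 / 2) = 1%:M := mxpowVl _ pX.
have e2 : mxpow X (1 / 2) *m mxpow X (- (1 / 2)) = 1%:M := mxpowVr _ pX.
have e3 : mxpow X (- (1 / 2)) *m mxpow X (- (1 / 2)) = mxpow X (- 1).
  by rewrite (mxpowD _ _ pX) -opprD -splitr.
have e4 : mxpow Y (- (1 / 2)) *m mxpow Y (- (1 / 2)) = mxpow Y (- 1).
  by rewrite (mxpowD _ _ pY) -opprD -splitr.
have hX := mxpow_herm X (1 / 2); have hY := mxpow_herm Y (- (1 / 2)).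
move: (mxpow X (1 / 2)) (mxpow X (- (1 / 2))) (mxpow Y (- (1 / 2))) e1 e2 e3 e4
  hX hY => P P' Q e1 e2 e3 e4 hP hQ.
rewrite adj_mul hP hQ mulmx1 e3 !mulmxA e1 mul1mx -(mulmxA _ P P') e2 mulmx1.
by rewrite e4.
Qed.

Variable f : R -> R.
Hypothesis f_OM : OM_plus1 f.
Hypothesis f_pow : forall x r : R, 0 <= x -> 1 <= r -> f x `^ r <= f (x `^ r).

Lemma conj_scale n (a : R) (P X : 'M[C]_n) :
  (a%:C *: P) *m X *m (a%:C *: P) = (a * a)%:C *: (P *m X *m P).
Proof. by rewrite -scalemxAr -!scalemxAl scalerA rmorphM. Qed.

Lemma opmean_pos_scale l (t : R) (A B : 'M[C]_l) : 0 < t -> psdmx A ->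
  opmean_pos f (t%:C *: A) (t%:C *: B) = t%:C *: opmean_pos f A B.
Proof.
move=> t0 pA; rewrite /opmean_pos !(mxpow_scale _ (ltW t0) pA).
have t12 : t `^ 2^-1 * t `^ 2^-1 = t.
  rewrite -powRD; last by rewrite [t == 0]gt_eqF// implybT.
  by rewrite -[2^-1]div1r -splitr powRr1// ltW.
have tN : t `^ (- 2^-1) * t `^ (- 2^-1) * t = 1.
  rewrite powRN -invfM t12 mulVf// gt_eqF//.
move: (mxpow A 2^-1) (mxpow A (- 2^-1)) => P Q.
have -> : ((t `^ (- 2^-1))%:C *: Q) *m (t%:C *: B) *m ((t `^ (- 2^-1))%:C *: Q)
          = Q *m B *m Q.
  by rewrite conj_scale -scalemxAr -scalemxAl scalerA -rmorphM tN scale1r.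
by rewrite conj_scale t12.
Qed.

Lemma opmean_pos_commute l (X : 'M[C]_l) (g h : R -> R) : pdmx X ->
  (forall x, 0 < x -> 0 < g x) ->
  opmean_pos f (mxfun g X) (mxfun h X) = mxfun (fun x => g x * f (h x / g x)) X.
Proof.
move=> pX g0; rewrite /opmean_pos.
have e1 r : mxpow (mxfun g X) r = mxfun (fun x => g x `^ r) X.
  by rewrite (mxpowE (mxfun g X)) mxfun_comp.
have e2 p q : mxfun p X *m mxfun q X *m mxfun p X =
              mxfun (fun x => p x * q x * p x) X by rewrite !mxfunM.
move: (e1 2^-1) (e1 (- 2^-1)).
move: (mxpow (mxfun g X) 2^-1) (mxpow (mxfun g X) (- 2^-1)) => P Q eP eQ.
have eQQ : Q *m mxfun h X *m Q =
    mxfun (fun x => g x `^ (- 2^-1) * h x * g x `^ (- 2^-1)) X.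
  by rewrite eQ; exact (e2 (fun x => g x `^ (- 2^-1)) h).
apply: (etrans (congr1 (fun Y => P *m mxfun f Y *m P) eQQ)).
rewrite mxfun_comp eP e2; apply: eq_mxfun_pd; first exact: pX.
move=> x /g0 gx /=.
have half (r : R) : g x `^ r * g x `^ r = g x `^ (r + r).
  by rewrite -powRD// [g x == 0]gt_eqF// implybT.
rewrite mulrAC half -[2^-1]div1r -splitr powRr1 ?(ltW gx)//.
by rewrite mulrAC half -opprD -splitr powR_inv1 ?(ltW gx)// [_^-1 * _]mulrC.
Qed.

Lemma pd_conj n (S B : 'M[C]_n) : S ^t* = S -> pdmx (S *m S) -> pdmx B ->
  pdmx (S *m B *m S).
Proof.
move=> hS [d d0 hd] [e e0 /(loewner_conj hS)].
rewrite mul_mx_scalar -scalemxAl => h; exists (e * d); first exact: mulr_gt0.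
apply: loewner_trans h; rewrite rmorphM -scale_scalar_mx.
exact: (loewner_scale (ltW e0) hd).
Qed.

Lemma mxpow_invsqrtM n (A : 'M[C]_n) : pdmx A ->
  mxpow A (- 2^-1) *m mxpow A (- 2^-1) = mxpow A (- 1).
Proof.
move=> pA; have := mxpowD (- 2^-1) (- 2^-1) pA.
by have -> : - 2^-1 + - 2^-1 = - 1 :> R by field.
Qed.

Lemma mxpow_addM n (A : 'M[C]_n) t u p : pdmx A ->
  mxpow (mxpow A (t + u)) p = mxpow (mxpow A t) p *m mxpow (mxpow A u) p.
Proof.
move=> pA; apply: (etrans (mxpow_comp A (t + u) p)).
apply: (etrans (congr1 (mxpow A) (mulrDl t u p))).
apply: (etrans (esym (mxpowD (t * p) (u * p) pA))).
exact (congr2 mulmx (esym (mxpow_comp A t p)) (esym (mxpow_comp A u p))).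
Qed.

Lemma conj_mxfun_regroup n (a b P Q P1 Q1 Y : 'M[C]_n) :
  P1 = a *m P -> P1 = P *m a -> Q1 = b *m Q -> Q1 = Q *m b ->
  P1 *m mxfun f (Q1 *m Y *m Q1) *m P1 =
  a *m (P *m mxfun f (Q *m (b *m Y *m b) *m Q) *m P) *m a.
Proof.
move=> e1 e2 e3 e4.
have -> : Q1 *m Y *m Q1 = Q *m (b *m Y *m b) *m Q by rewrite {1}e4 e3 !mulmxA.
by move: (mxfun f _) => F; rewrite {1}e1 e2 !mulmxA.
Qed.

(** Powers of [A] commute, so a factor [A^(1/2)] comes out of the mean on both sides and its first
    argument keeps only the power [s], to which Loewner-Heinz applies. *)
Lemma opmean_pos_mxpow l (A Y : 'M[C]_l) s : pdmx A ->
  opmean_pos f (mxpow A (1 + s)) Y =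
  mxpow A 2^-1 *m opmean_pos f (mxpow A s)
    (mxpow A (- 2^-1) *m Y *m mxpow A (- 2^-1)) *m mxpow A 2^-1.
Proof.
move=> pA.
have el p := mxpow_addM 1 s p pA; have er p := mxpow_addM s 1 p pA.
rewrite (mxpow1 (pd_psd pA)) in el er; rewrite [s + 1]addrC in er.
exact (conj_mxfun_regroup Y (el _) (er _) (el _) (er _)).
Qed.

Lemma opmean_pos_ge1 l (A B : 'M[C]_l) : pdmx A ->
  loewner_le 1%:M (opmean_pos f A B) ->
  loewner_le (mxpow A (- 1))
    (mxfun f (mxpow A (- 2^-1) *m B *m mxpow A (- 2^-1))).
Proof.
move=> pA; rewrite /opmean_pos.
have aa' := mxpowVr 2^-1 pA; have a'a := mxpowVl 2^-1 pA.
have a'a' := mxpow_invsqrtM pA.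
move: (mxfun f _) => F /(loewner_conj (mxpow_herm A (- 2^-1))).
move: (mxpow A (- 1)) (mxpow A 2^-1) (mxpow A (- 2^-1)) aa' a'a a'a'.
move=> A' a a' aa' a'a a'a'.
by rewrite mulmx1 a'a' !mulmxA a'a mul1mx -mulmxA aa' mulmx1.
Qed.

(** In use [a] and [c] are the square roots of [A] and [D], and [a'] inverts [a]. Then [B] is the
    Gram matrix of [c a], and [mxpow_gram] applies. *)
Lemma mxpow_conj_gram l (a a' c D A B : 'M[C]_l) s : 0 <= s ->
  a ^t* = a -> c ^t* = c -> a *m a' = 1%:M -> a' *m a = 1%:M -> a *m a = A ->
  c *m c = D -> D = a' *m B *m a' ->
  a' *m mxpow B (1 + s) *m a' = c *m mxpow (c *m A *m c) s *m c.
Proof.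
move=> s0 ha hc aa' a'a aa cc DE.
have BE : (c *m a) ^t* *m (c *m a) = B.
  rewrite adj_mul ha hc !mulmxA -(mulmxA a) cc DE !mulmxA aa' mul1mx.
  by rewrite -mulmxA a'a mulmx1.
have := mxpow_gram (c *m a) s0; rewrite BE => ->.
have -> : c *m a *m (c *m a) ^t* = c *m A *m c.
  by rewrite adj_mul ha hc -aa !mulmxA.
move: (mxpow (c *m A *m c) s) => Y.
by rewrite adj_mul ha hc !mulmxA a'a mul1mx -mulmxA aa' mulmx1.
Qed.

Lemma mxfun_sqrt_conj l (D : 'M[C]_l) h : pdmx D ->
  mxpow D 2^-1 *m mxfun h D *m mxpow D 2^-1 = mxfun (fun x => x * h x) D.
Proof.
move=> pD; rewrite (mxpowE D) !mxfunM; apply: eq_mxfun_pd; first exact: pD.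
move=> x x0 /=; rewrite mulrAC -powRD; last by rewrite [x == 0]gt_eqF// implybT.
by rewrite -[2^-1]div1r -splitr powRr1// ltW.
Qed.

(** Let [D = A^(-1/2) B A^(-1/2)]. The assumption reads [f(D) >= A^(-1)], that is [A >= f(D)^(-1)].
    Loewner-Heinz then gives [A^s >= f(D)^(-s)] and [(D^(1/2) A D^(1/2))^s >= (D / f(D))^s], the
    latter bounding [A^(-1/2) B^(1+s) A^(-1/2)] below by [D (D / f(D))^s]. Both bounds are functions
    of [D], and their mean is [f(D)^(-s) f(D^(1+s)) >= f(D)] by the hypothesis on [f]. Conjugating
    [f(D) >= A^(-1)] by [A^(1/2)] concludes. *)
Lemma ando_hiai1 l (A B : 'M[C]_l) s : pdmx A -> pdmx B -> 0 <= s <= 1 ->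
  loewner_le 1%:M (opmean_pos f A B) ->
  loewner_le 1%:M (opmean_pos f (mxpow A (1 + s)) (mxpow B (1 + s))).
Proof.
move=> pA pB s01 le1; have [s0 s1] := andP s01.
have f_gt0 := om_gt0 f_OM.
have leF := opmean_pos_ge1 pA le1.
rewrite (opmean_pos_mxpow _ s pA).
have [D DE] : exists D, D = mxpow A (- 2^-1) *m B *m mxpow A (- 2^-1).
  by eexists.
rewrite -DE in leF.
have pD : pdmx D.
  rewrite DE; apply: (pd_conj (mxpow_herm _ _) _ pB).
  by rewrite (mxpow_invsqrtM pA); apply: pd_mxpow.
have pF : pdmx (mxfun f D) by apply: pd_mxfun.
have leA : loewner_le (mxfun (fun x => (f x)^-1) D) A.
  have := loewner_inv (pd_mxpow _ pA) leF.
  rewrite mxpow_comp mulrNN mulr1 (mxpow1 (pd_psd pA)).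
  rewrite (mxpowE (mxfun f D)) mxfun_comp.
  suff -> : mxfun ((fun x => x `^ (- 1)) \o f) D = mxfun (fun x => (f x)^-1) D.
    by [].
  apply: (eq_mxfun_pd pD) => x x0 /=.
  by rewrite powR_inv1// ltW// f_gt0.
have pfV : psdmx (mxfun (fun x => (f x)^-1) D).
  by apply: pd_psd; apply: (pd_mxfun pD) => x x0; rewrite invr_gt0 f_gt0.
have leAs : loewner_le (mxfun (fun x => f x `^ (- s)) D) (mxpow A s).
  have := loewner_heinz pfV leA s01.
  rewrite (mxpowE (mxfun _ D)) mxfun_comp.
  suff -> : mxfun ((fun x => x `^ s) \o (fun x => (f x)^-1)) D =
            mxfun (fun x => f x `^ (- s)) D by [].
  apply: (eq_mxfun_pd pD) => x x0 /=; have fx := ltW (f_gt0 _ x0).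
  by rewrite -powR_inv1// -powRrM mulN1r.
have BrE : mxpow A (- 2^-1) *m mxpow B (1 + s) *m mxpow A (- 2^-1) =
    mxpow D 2^-1 *m mxpow (mxpow D 2^-1 *m A *m mxpow D 2^-1) s *m mxpow D 2^-1.
  exact (mxpow_conj_gram s0 (mxpow_herm A 2^-1) (mxpow_herm D 2^-1)
    (mxpowVr _ pA) (mxpowVl _ pA) (mxpow_sqrtM pA) (mxpow_sqrtM pD) DE).
rewrite BrE.
have leB : loewner_le (mxfun (fun x => x * (x / f x) `^ s) D)
    (mxpow D 2^-1 *m mxpow (mxpow D 2^-1 *m A *m mxpow D 2^-1) s *m mxpow D 2^-1).
  have h1 := loewner_conj (mxpow_herm D 2^-1) leA.
  rewrite (mxfun_sqrt_conj _ pD) in h1.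
  have p1 : psdmx (mxfun (fun x => x / f x) D).
    apply: pd_psd; apply: (pd_mxfun pD) => x x0.
    exact: divr_gt0 x0 (f_gt0 _ x0).
  have h2 := loewner_conj (mxpow_herm D 2^-1) (loewner_heinz p1 h1 s01).
  have e1 : mxpow (mxfun (fun x => x / f x) D) s =
            mxfun (fun x => (x / f x) `^ s) D.
    exact (etrans (mxpowE _ _) (mxfun_comp _ _ _)).
  have e2 := mxfun_sqrt_conj (fun x => (x / f x) `^ s) pD.
  exact (eq_ind _ (fun M => loewner_le M _) h2 _ (etrans
    (congr1 (fun M => mxpow D 2^-1 *m M *m mxpow D 2^-1) e1) e2)).
move: (mxpow D 2^-1 *m _ *m _) leB => Y leB {BrE DE}.
have pX1 : pdmx (mxfun (fun x => f x `^ (- s)) D).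
  by apply: (pd_mxfun pD) => x x0; apply/powR_gt0/f_gt0.
have pY1 : psdmx (mxfun (fun x => x * (x / f x) `^ s) D).
  apply: pd_psd; apply: (pd_mxfun pD) => x x0.
  exact: mulr_gt0 x0 (powR_gt0 _ (divr_gt0 x0 (f_gt0 _ x0))).
have := opmean_pos_monotone f_OM pX1 leAs pY1 leB.
rewrite (opmean_pos_commute _ pD); last by move=> x x0; apply/powR_gt0/f_gt0.
move: (opmean_pos f (mxpow A s) Y) => V leV.
have leFV : loewner_le (mxfun f D) V.
  apply: loewner_trans leV; apply/loewner_mxfun => j.
  have x0 := spectrum_gt0 j pD; move: (spectrum D j) x0 => x x0.
  have fx := f_gt0 _ x0; have xge := ltW x0; have fge := ltW fx.
  have xN0 : x != 0 by rewrite gt_eqF.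
  have fN0 : f x != 0 by rewrite gt_eqF.
  have -> : x * (x / f x) `^ s / f x `^ (- s) = x `^ (1 + s).
    rewrite powRM ?invr_ge0// -(powR_inv1 fge) -powRrM mulN1r.
    rewrite mulrA mulfK ?gt_eqF ?powR_gt0//.
    by rewrite powRD ?xN0 ?implybT// powRr1.
  have h : f x `^ (1 + s) <= f (x `^ (1 + s)) by apply: f_pow; rewrite ?lerDl.
  have := ler_wpM2l (powR_ge0 (f x) (- s)) h.
  rewrite -powRD ?fN0 ?implybT// addrCA addNr addr0.
  by rewrite (powRr1 fge).
have := loewner_conj (mxpow_herm A 2^-1) (loewner_trans leF leFV).
rewrite -(mxpow_invsqrtM pA).
move: (mxpow A 2^-1) (mxpow A (- 2^-1)) (mxpowVr 2^-1 pA) (mxpowVl 2^-1 pA).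
by move=> a a' aa' a'a; rewrite !mulmxA aa' mul1mx a'a.
Qed.

(** The mean is homogeneous of degree one in the pair, so dividing both arguments by [t] reduces to
    [t = 1]. *)
Lemma ando_hiai l (A B : 'M[C]_l) s (t : R) : pdmx A -> pdmx B ->
  0 <= s <= 1 -> 0 < t -> loewner_le t%:C%:M (opmean_pos f A B) ->
  loewner_le (t `^ (1 + s))%:C%:M
    (opmean_pos f (mxpow A (1 + s)) (mxpow B (1 + s))).
Proof.
move=> pA pB s01 t0 le; have tV0 : 0 < t^-1 by rewrite invr_gt0.
have pdZ (X : 'M[C]_l) : pdmx X -> pdmx ((t^-1)%:C *: X).
  move=> [e e0 h]; exists (t^-1 * e); first exact: mulr_gt0.
  by rewrite rmorphM -scale_scalar_mx; apply: (loewner_scale (ltW tV0) h).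
have le1 : loewner_le 1%:M (opmean_pos f ((t^-1)%:C *: A) ((t^-1)%:C *: B)).
  rewrite (opmean_pos_scale _ tV0 (pd_psd pA)).
  have := loewner_scale (ltW tV0) le.
  by rewrite scale_scalar_mx -rmorphM mulVf ?gt_eqF.
have := ando_hiai1 (pdZ _ pA) (pdZ _ pB) s01 le1.
rewrite (mxpow_scale _ (ltW tV0) (pd_psd pA)).
rewrite (mxpow_scale _ (ltW tV0) (pd_psd pB)).
have tr0 : 0 < t^-1 `^ (1 + s) by apply: powR_gt0.
rewrite (opmean_pos_scale _ tr0 (psd_mxpow _ _)).
have e : t `^ (1 + s) * t^-1 `^ (1 + s) = 1.
  by rewrite -(powRM _ (ltW t0) (ltW tV0)) mulfV ?powR1// gt_eqF.
move: (opmean_pos f (mxpow A _) _) => V.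
move=> /(loewner_scale (powR_ge0 t (1 + s))).
by rewrite scalerA -rmorphM e scale1r scalemx1.
Qed.

End AndoHiai.

(** * Smallest eigenvalue, operator norm and monotone limits *)

Section Eigenvalues.
Context {R : realType}.
Local Notation C := R[i].

(** Bridges the roots of the characteristic polynomial and the spectral decomposition: unitary
    similarity leaves the characteristic polynomial unchanged. *)
Lemma eigenvalues_spectrum n (A : 'M[C]_n) : A ^t* = A ->
  perm_eq [seq complex.Re z | z <- eigenvalues A] [seq spectrum A j | j : 'I_n].
Proof.
move=> hA.
have cE : char_poly A = \prod_(j < n) ('X - ((spectrum A j)%:C)%:P).
  pose U := map_mx polyC (spectralmx A); pose V := map_mx polyC ((spectralmx A) ^t*).
  have VU : V *m U = 1%:M by rewrite /V /U -map_mxM spectral_adjM map_mx1.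
  have -> : char_poly A = char_poly (rdiag (spectrum A)).
    rewrite /char_poly.
    have -> : char_poly_mx A = V *m char_poly_mx (rdiag (spectrum A)) *m U.
      rewrite /char_poly_mx mulmxBr mulmxBl scalar_mxC -(mulmxA _ V U) VU mulmx1.
      by rewrite /V /U -!map_mxM -(hermE hA).
    by rewrite !det_mulmx mulrAC -det_mulmx VU det1 mul1r.
  rewrite char_poly_trig; last first.
    by apply/is_trig_mxP => i j ij; rewrite !mxE -val_eqE/= ltn_eqF.
  by apply: eq_bigr => j _; rewrite !mxE eqxx mulr1n.
have pE : perm_eq (eigenvalues A) [seq (spectrum A j)%:C | j : 'I_n].
  apply: prod_XsubC_eq; rewrite big_map big_enum /= -cE /eigenvalues.
  case: closed_field_poly_normal => r /= ->.
  have /eqP := char_poly_monic A; rewrite /monic => mA.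
  by rewrite (eqP (char_poly_monic A)) scale1r.
apply: perm_trans (perm_map _ pE) _.
by rewrite -map_comp.
Qed.

(** [lambda n] reads position [n.-1] of the decreasing list, its last entry; [0 < n] keeps this
    inside the list, away from the default 0 of [nth]. *)
Lemma lambda_minP n (A : 'M[C]_n) : (0 < n)%N -> A ^t* = A ->
  (exists j, lambda n A = spectrum A j) /\ forall j, lambda n A <= spectrum A j.
Proof.
move=> n0 hA; have pE := eigenvalues_spectrum hA.
rewrite /lambda; set s := sort _ _.
have sE : perm_eq s [seq spectrum A j | j : 'I_n].
  by rewrite /s perm_sort.
have sz : size s = n by rewrite (perm_size sE) size_map size_enum_ord.
have last_lt : (n.-1 < size s)%N by rewrite sz prednK.
split.
  have := mem_nth 0 last_lt; rewrite (perm_mem sE) => /mapP[j _ ->].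
  by exists j.
move=> j; have : spectrum A j \in s.
  by rewrite (perm_mem sE); apply: map_f; rewrite mem_enum.
move=> /(nthP 0)[k ks <-].
have srt : sorted (fun x y : R => y <= x) s.
  by apply: sort_sorted => x y; apply: le_total.
apply: (sorted_leq_nth _ _ 0 srt) => //.
  by move=> x y z xy yz; apply: le_trans yz xy.
by rewrite -ltnS prednK// -sz.
Qed.

Lemma lambda_lower n (A : 'M[C]_n) : (0 < n)%N -> A ^t* = A ->
  loewner_le (lambda n A)%:C%:M A.
Proof. by move=> n0 hA; apply/(spectrum_ge _ hA); case: (lambda_minP n0 hA). Qed.

Lemma le_lambda n (A : 'M[C]_n) (t : R) : (0 < n)%N -> A ^t* = A ->
  loewner_le t%:C%:M A -> t <= lambda n A.
Proof.
move=> n0 hA /(spectrum_ge _ hA) h.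
by case: (lambda_minP n0 hA) => -[j ->] _.
Qed.

Lemma cvnormE n (v : 'cV[C]_n) : cvnorm v = Num.sqrt (qform 1%:M v).
Proof.
rewrite /cvnorm /qform mulmx1 mxE raddf_sum; congr Num.sqrt.
apply: eq_bigr => i _; rewrite !mxE; case: (v i ord0) => a b.
rewrite /= sqr_sqrtr ?addr_ge0 ?sqr_ge0// !expr2.
by rewrite mulNr opprK.
Qed.

Lemma qform_gramv n (A : 'M[C]_n) v : qform 1%:M (A *m v) = qform (A ^t* *m A) v.
Proof. by rewrite -qform_congr mulmx1. Qed.

(** Each eigenvalue is the norm of the image of a unit eigenvector, hence below the supremum once
    the set is known to be bounded. *)
Lemma psd_le_opnorm n (A : 'M[C]_n) : psdmx A -> loewner_le A (opnorm A)%:C%:M.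
Proof.
move=> pA; have hA := psd_herm pA; apply/(spectrum_le _ hA) => j.
(* The trace, a crude bound on every eigenvalue, serves to bound the set whose supremum is
   [opnorm]. *)
pose M := \sum_k spectrum A k.
have M0 k : spectrum A k <= M.
  rewrite /M (bigD1 k)//= lerDl sumr_ge0// => i _; exact: spectrum_ge0.
have sj := spectrum_ge0 j pA.
pose w := (spectralmx A) ^t* *m delta_mx j (0 : 'I_1).
have w1 : qform 1%:M w = 1.
  rewrite /w qform_gramv trmxCK spectral_Madj.
  rewrite /qform mulmx1 mxE (bigD1 j)//= big1 => [|k /negPf kj].
    by rewrite !mxE !eqxx rmorph1 mul1r addr0.
  by rewrite !mxE kj mulr0.
have Aw : A *m w = (spectrum A j)%:C *: w.
  rewrite /w mulmxA (spectral_mulr hA) -mulmxA scalemxAr; congr (_ *m _).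
  apply/matrixP => k l; rewrite /rdiag mul_diag_mx !mxE.
  by have [->|] := eqVneq k j; rewrite ?mulr0.
have -> : spectrum A j = cvnorm (A *m w).
  by rewrite cvnormE Aw qform_scalev w1 mulr1 sqrtr_sqr ger0_norm.
apply: ub_le_sup; last first.
  by exists w => //=; rewrite cvnormE w1 sqrtr1.
exists M => _ /= [v v1 <-].
have Mpos : 0 <= M := le_trans sj (M0 j).
rewrite cvnormE in v1; have v0 := qform_ge0 v (psd1 n).
have {}v1 : qform 1%:M v <= 1.
  by rewrite -(sqr_sqrtr v0) -[leRHS](expr1n _ 2) ler_pXn2r// ?nnegrE ?sqrtr_ge0.
rewrite cvnormE qform_gramv hA.
have leM : loewner_le (A *m A) (M ^+ 2)%:C%:M.
  rewrite -{1 2}(mxfun_id hA) mxfunM -(mxfun_cst (M ^+ 2) A).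
  by apply/loewner_mxfun => k; rewrite -expr2 ler_pXn2r// nnegrE ?spectrum_ge0.
have hAA : (A *m A) ^t* = A *m A by rewrite adj_mul hA.
have := (loewnerP hAA (adj_scalar _ _)).1 leM v.
rewrite -scalemx1 qformZ => h.
rewrite -(ler_pXn2r (n := 2))// ?nnegrE ?sqrtr_ge0//.
rewrite sqr_sqrtr; last by rewrite -[X in X *m A]hA; apply/qform_ge0/psd_gram.
by apply: le_trans h _; rewrite ler_piMr// sqr_ge0.
Qed.

End Eigenvalues.

Local Open Scope classical_set_scope.

Section MonotoneLimit.
Context {R : realType}.
Local Notation C := R[i].

Lemma ltr0c (d : R) : (0 < d%:C :> C) = (0 < d).
Proof. exact: (ltcR 0 d). Qed.

(** An explicit form, with real tolerances, of the convergence in which [opmean] takes its limit. *)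
Definition entrywise_cvg l (M : R -> 'M[C]_l) (L : 'M[C]_l) : Prop :=
  forall d : R, 0 < d ->
    \forall e \near 0^'+, forall i j, `|M e i j - L i j| < d%:C.

Lemma entrywise_cvgP l (M : R -> 'M[C]_l) (L : 'M[C]_l) :
  entrywise_cvg M L <->
  (M : R -> 'M[C^o]_l) @ 0^'+ --> (L : 'M[C^o]_l).
Proof.
split=> [h P [Q LQ sQP]|h d d0].
  have hQ i j : \forall e \near 0^'+, Q i j (M e i j).
    have := LQ i j => /nbhs_ballP[r /= r0 hr].
    (* A positive element of the complex field is real, so balls of real radius suffice. *)
    have rE : r = (complex.Re r)%:C by rewrite RRe_real// gtr0_real.
    have r0' : 0 < complex.Re r by rewrite -ltr0c -rE.
    apply: filterS (h _ r0') => e /(_ i j); rewrite -rE => he.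
    by apply: hr; rewrite -ball_normE /ball_ /= distrC.
  apply: (@filterS _ (0^'+) _ _ _ _
    (@filter_forall _ 'I_l _ _ _ (fun i =>
      @filter_forall _ 'I_l _ _ _ (hQ i)))).
  by move=> e he; apply: sQP.
apply: (h [set N : 'M[C^o]_l | forall i j, `|N i j - L i j| < d%:C]).
exists (fun i j => [set z : C^o | `|z - L i j| < d%:C]).
  move=> i j; apply/nbhs_ballP; exists (d%:C); first by rewrite /= ltr0c.
  by move=> z; rewrite -ball_normE /ball_ /= distrC.
by [].
Qed.

Lemma qform_small l (H : 'M[C]_l) v (d : R) : (forall i j, `|H i j| <= d%:C) ->
  `|qform H v| <= d * complex.Re (\sum_j \sum_i `|v i 0| * `|v j 0|).
Proof.
move=> h; rewrite -lecR; apply: le_trans (normc_ge_Re _) _.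
set S := \sum_j \sum_i _.
have S0 : 0 <= S.
  by apply: sumr_ge0 => j _; apply: sumr_ge0 => i _; apply: mulr_ge0.
have -> : (d * complex.Re S)%:C = d%:C * S.
  by rewrite -{2}(RRe_real (ger0_real S0)); apply: rmorphM.
rewrite mxE; apply: le_trans (ler_norm_sum _ _ _) _.
rewrite mulr_sumr; apply: ler_sum => j _.
rewrite normrM mxE mulr_sumr.
apply: le_trans (ler_wpM2r (normr_ge0 _) (ler_norm_sum _ _ _)) _.
rewrite mulr_suml; apply: ler_sum => i _.
rewrite !mxE normrM norm_conjC mulrA; apply: ler_wpM2r => //.
by rewrite mulrC; apply: ler_wpM2r.
Qed.

Lemma entrywise_cvg_qform l (M : R -> 'M[C]_l) L v : entrywise_cvg M L ->
  qform (M e) v @[e --> 0^'+] --> qform L v.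
Proof.
move=> h; apply/cvgrPdist_lt => d d0.
pose K := complex.Re (\sum_j \sum_i `|v i 0| * `|v j 0|).
have K0 : 0 <= K.
  have : 0 <= \sum_j \sum_i `|v i 0| * `|v j 0|.
    by apply: sumr_ge0 => j _; apply: sumr_ge0 => i _; apply: mulr_ge0.
  by rewrite lecE => /andP[].
have k0 : 0 < d / (K + 1) by rewrite divr_gt0// ltr_wpDl.
apply: filterS (h _ k0) => e he.
rewrite distrC -qformB.
have := @qform_small _ (M e - L) v (d / (K + 1)) _.
rewrite -/K => le; apply: le_lt_trans (le _) _.
  by move=> i j; rewrite !mxE ltW.
by rewrite mulrAC ltr_pdivrMr ?ltr_wpDl// mulrDr mulr1 ltrDl.
Qed.

Lemma entrywise_cvg_herm l (M : R -> 'M[C]_l) L :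
  (forall e, 0 < e -> (M e) ^t* = M e) -> entrywise_cvg M L -> L ^t* = L.
Proof.
move=> hM h; apply/matrixP => i j; rewrite !mxE.
apply/eqP; rewrite -subr_eq0 -normr_eq0 eq_le normr_ge0 andbT.
have nE (z : C) : `|z| = (complex.Re `|z|)%:C by rewrite RRe_real// normr_real.
rewrite nE -[0]/(0%:C) lecR; apply/ler_addgt0Pr => d d0; rewrite add0r.
have d2 : 0 < d / 2 by rewrite divr_gt0.
near (0:R)^'+ => e.
have e0 : 0 < e by near: e; apply: nbhs_right_gt.
have he : forall i j, `|M e i j - L i j| < (d / 2)%:C by near: e; apply: h.
rewrite -lecR -nE.
have -> : Num.conj (L j i) - L i j =
    Num.conj (L j i - M e j i) + (M e i j - L i j).
  have hc : Num.conj (M e j i) = M e i j.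
    by have /matrixP/(_ i j) := hM _ e0; rewrite !mxE.
  rewrite rmorphB /= hc.
  by rewrite addrA subrK.
apply: le_trans (ler_normD _ _) _; rewrite norm_conjC distrC.
by rewrite (splitr d) rmorphD lerD// ltW.
Unshelve. all: by end_near. Qed.

Definition basis_cv l (i : 'I_l) : 'cV[C]_l := delta_mx i 0.

Lemma form_delta l (H : 'M[C]_l) i j :
  ((basis_cv i) ^t* *m H *m basis_cv j) 0 0 = H i j.
Proof.
rewrite /basis_cv.
have -> : (delta_mx i 0 : 'cV[C]_l) ^t* = delta_mx 0 i.
  by rewrite trmx_delta map_delta_mx.
by rewrite -rowE -colE !mxE.
Qed.

Lemma qform_polar l (H : 'M[C]_l) u w : H ^t* = H ->
  qform H (u + w) - qform H u - qform H w =
  2 * complex.Re ((u ^t* *m H *m w) 0 0).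
Proof.
move=> hH.
have hc : w ^t* *m H *m u = (u ^t* *m H *m w) ^t*.
  by rewrite !adj_mul trmxCK hH mulmxA.
rewrite /qform adj_add !mulmxDl !mulmxDr hc.
move: (u ^t* *m H *m u) (w ^t* *m H *m w) (u ^t* *m H *m w) => X Y Z.
rewrite !mxE; case: (X 0 0) (Y 0 0) (Z 0 0) => a b [c d] [p q] /=.
by ring.
Qed.

(** Monotone convergence is available for quadratic forms only; this recovers each entry from
    finitely many of them. The minus sign comes from [Re (i z) = - Im z]. *)
Lemma polarization l (H : 'M[C]_l) i j : H ^t* = H ->
  H i j =
  Complex ((qform H (basis_cv i + basis_cv j)
            - qform H (basis_cv i) - qform H (basis_cv j)) / 2)
          (- ((qform H (basis_cv i + (Complex 0 1) *: basis_cv j)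
            - qform H (basis_cv i) - qform H ((Complex 0 1) *: basis_cv j)) / 2)).
Proof.
move=> hH; rewrite !(qform_polar _ _ hH) form_delta.
rewrite -scalemxAr [X in - (2 * complex.Re X / 2)]mxE form_delta.
case: (H i j) => a b /=.
by congr Complex; field.
Qed.

End MonotoneLimit.

(** * Existence of the operator mean and its behaviour under positive maps *)

Section OperatorMean.
Context {R : realType}.
Local Notation C := R[i].

Lemma norm_complex_le (a b : R) : `|Complex a b| <= (`|a| + `|b|)%:C.
Proof.
rewrite normc_def /= lecR -(ler_pXn2r (n := 2))// ?nnegrE ?sqrtr_ge0 ?addr_ge0//.
rewrite sqr_sqrtr ?addr_ge0 ?sqr_ge0// sqrrD !real_normK ?num_real//.
by rewrite lerD2r lerDl mulrn_wge0// mulr_ge0.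
Qed.

(** Each quadratic form is nondecreasing in [e] and bounded below by 0, so it has a limit from the
    right at 0; polarization carries the convergence over to the entries. *)
Lemma psd_nondecreasing_cvg l (M : R -> 'M[C]_l) :
  (forall e, 0 < e -> psdmx (M e)) ->
  (forall e1 e2, 0 < e1 -> e1 <= e2 -> loewner_le (M e1) (M e2)) ->
  exists L, entrywise_cvg M L.
Proof.
move=> pM mM.
have cq v : qform (M e) v @[e --> 0^'+] --> lim (qform (M e) v @[e --> 0^'+]).
  apply: nondecreasing_at_right_is_cvgr; near=> e.
    move=> x y; rewrite !in_itv /= => /andP[x0 _] /andP[y0 _] xy.
    have le := mM _ _ x0 xy.
    exact: (loewnerP (psd_herm (pM _ x0)) (psd_herm (pM _ y0))).1 le v.
  exists 0 => _ /= [x hx <-]; move: hx; rewrite in_itv /= => /andP[x0 _].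
  exact: qform_ge0 (pM _ x0).
pose q v := lim (qform (M e) v @[e --> 0^'+]).
pose u (i : 'I_l) : 'cV[C]_l := basis_cv i.
pose w (i : 'I_l) : 'cV[C]_l := (Complex 0 1) *: basis_cv i.
pose re e i j :=
  (qform (M e) (u i + u j) - qform (M e) (u i) - qform (M e) (u j)) / 2.
pose im e i j :=
  - ((qform (M e) (u i + w j) - qform (M e) (u i) - qform (M e) (w j)) / 2).
pose rel i j := (q (u i + u j) - q (u i) - q (u j)) / 2.
pose iml i j := - ((q (u i + w j) - q (u i) - q (w j)) / 2).
have cre i j : re e i j @[e --> 0^'+] --> rel i j.
  by apply: cvgM; [apply: cvgB; [apply: cvgB|]; exact: cq | exact: cvg_cst].
have cim i j : im e i j @[e --> 0^'+] --> iml i j.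
  apply: cvgN; apply: cvgM; last exact: cvg_cst.
  by apply: cvgB; [apply: cvgB|]; exact: cq.
exists (\matrix_(i, j) Complex (rel i j) (iml i j)) => d d0.
have d2 : 0 < d / 2 by rewrite divr_gt0.
have nre0 i j : \forall e \near 0^'+, `|rel i j - re e i j| < d / 2.
  by move/cvgrPdist_lt: (cre i j); apply.
have nre : \forall e \near 0^'+, forall i j, `|rel i j - re e i j| < d / 2.
  exact (@filter_forall _ 'I_l _ _ _ (fun i => @filter_forall _ 'I_l _ _ _ (nre0 i))).
have nim0 i j : \forall e \near 0^'+, `|iml i j - im e i j| < d / 2.
  by move/cvgrPdist_lt: (cim i j); apply.
have nim : \forall e \near 0^'+, forall i j, `|iml i j - im e i j| < d / 2.
  exact (@filter_forall _ 'I_l _ _ _ (fun i => @filter_forall _ 'I_l _ _ _ (nim0 i))).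
near=> e => i j.
have e0 : 0 < e by near: e; apply: nbhs_right_gt.
rewrite (polarization i j (psd_herm (pM _ e0))) mxE.
have -> : Complex (re e i j) (im e i j) - Complex (rel i j) (iml i j) =
   Complex (re e i j - rel i j) (im e i j - iml i j) by [].
apply: le_lt_trans (norm_complex_le _ _) _.
rewrite ltcR (splitr d) ltrD// distrC.
  by move: i j; near: e; exact: nre.
by move: i j; near: e; exact: nim.
Unshelve. all: by end_near. Qed.

Lemma entrywise_cvg_ge l (M : R -> 'M[C]_l) (L N : 'M[C]_l) :
  (forall e, 0 < e -> (M e) ^t* = M e) -> entrywise_cvg M L -> N ^t* = N ->
  (forall e, 0 < e -> loewner_le N (M e)) -> loewner_le N L.
Proof.
move=> hM cM hN le; have hL := entrywise_cvg_herm hM cM.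
apply/(loewnerP hN hL) => v; have cv := entrywise_cvg_qform (v := v) cM.
rewrite -(cvg_lim _ cv)//; apply: limr_ge; first by apply/cvg_ex; eexists; exact: cv.
near=> e; have e0 : 0 < e by near: e; apply: nbhs_right_gt.
exact: (loewnerP hN (hM _ e0)).1 (le _ e0) v.
Unshelve. all: by end_near. Qed.

Lemma entrywise_cvg_le l (M : R -> 'M[C]_l) (L : 'M[C]_l) (e1 : R) :
  (forall e, 0 < e -> (M e) ^t* = M e) -> entrywise_cvg M L ->
  (forall e1 e2, 0 < e1 -> e1 <= e2 -> loewner_le (M e1) (M e2)) ->
  0 < e1 -> loewner_le L (M e1).
Proof.
move=> hM cM mM e10; have hL := entrywise_cvg_herm hM cM.
apply/(loewnerP hL (hM _ e10)) => v; have cv := entrywise_cvg_qform (v := v) cM.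
rewrite -(cvg_lim _ cv)//; apply: limr_le; first by apply/cvg_ex; eexists; exact: cv.
near=> e; have e0 : 0 < e by near: e; apply: nbhs_right_gt.
have ee1 : e <= e1 by near: e; apply: nbhs_right_le.
exact: (loewnerP (hM _ e0) (hM _ e10)).1 (mM _ _ e0 ee1) v.
Unshelve. all: by end_near. Qed.

Variable f : R -> R.
Hypothesis f_OM : OM_plus1 f.

(** Everything that is used later about the limit: for comparison with scalar matrices it behaves as
    the infimum of the shifted means. *)
Lemma opmean_inf l (A B : 'M[C]_l) : psdmx A -> psdmx B ->
  [/\ psdmx (opmean f A B),
      forall e, 0 < e ->
        loewner_le (opmean f A B) (opmean_pos f (A + e%:C%:M) (B + e%:C%:M)) &
      forall t : R, (forall e, 0 < e ->
        loewner_le t%:C%:M (opmean_pos f (A + e%:C%:M) (B + e%:C%:M))) ->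
        loewner_le t%:C%:M (opmean f A B)].
Proof.
move=> pA pB.
pose M (e : R) := opmean_pos f (A + e%:C%:M) (B + e%:C%:M).
have pM e : 0 < e -> psdmx (M e).
  by move=> e0; apply: (psd_opmean_pos f_OM); apply/pd_psd/psd_pdD.
have hM e : 0 < e -> (M e) ^t* = M e by move=> e0; apply/psd_herm/pM.
have mM e1 e2 : 0 < e1 -> e1 <= e2 -> loewner_le (M e1) (M e2).
  move=> e10 e12; have le := loewner_scalar l e12.
  apply: (opmean_pos_monotone f_OM).
  - exact: psd_pdD.
  - exact: loewner_add (loewner_refl A) le.
  - by apply/pd_psd/psd_pdD.
  - exact: loewner_add (loewner_refl B) le.
have [L0 /entrywise_cvgP cL0] := psd_nondecreasing_cvg pM mM.
have cM : entrywise_cvg M (opmean f A B).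
  by apply/entrywise_cvgP; apply: (cvgP _ cL0).
split.
- apply/loewner0; apply: (entrywise_cvg_ge hM cM (adj0 _ _)) => e e0.
  exact ((loewner0 _).1 (pM e e0)).
- by move=> e e0; apply: (entrywise_cvg_le hM cM mM).
- by move=> t ht; apply: (entrywise_cvg_ge hM cM (adj_scalar _ _)).
Qed.

Hypothesis f_pow : forall x r : R, 0 <= x -> 1 <= r -> f x `^ r <= f (x `^ r).

(** Ando-Hiai is applied at [Phi A + d], whereas the mean to be bounded is shifted by [delta] at
    [Phi (A^(1+s))]. Right continuity lets [d] be chosen after [delta] to fit the first under the
    second. *)
Lemma mxpow_positive_map_slack l n (Phi : {linear 'M[C]_n -> 'M[C]_l}) (A : 'M[C]_n)
    (c s delta : R) :
  positive_map Phi -> psdmx A -> 0 < c -> loewner_le (Phi 1%:M) c%:C%:M ->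
  0 <= s <= 1 -> 0 < delta ->
  exists2 d0 : R, 0 < d0 & forall d, 0 <= d <= d0 ->
    loewner_le (mxpow (Phi A + d%:C%:M) (1 + s))
      ((c `^ s)%:C *: (Phi (mxpow A (1 + s)) + delta%:C%:M)).
Proof.
move=> pPhi pA c0 leP s01 delta0; have [s0 s1] := andP s01.
have s10 : 0 < 1 + s by rewrite ltr_wpDr.
have cd0 : 0 < c `^ s * delta by rewrite mulr_gt0// powR_gt0.
have [d0 d00 hd] := mxpow_right_continuous (pPhi _ pA) s10 cd0.
exists d0; first exact: d00.
move=> d /hd; apply: (fun x y => loewner_trans y x).
rewrite scalerDr scale_scalar_mx -rmorphM.
apply: loewner_add (loewner_refl _).
exact: positive_map_mxpow.
Qed.

(** For each shift [delta] a common small [d] serves [Phi] and [Psi]; monotonicity of the mean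
    carries the Ando-Hiai bound over to the arguments shifted by [delta], and homogeneity brings out
    the factor [c^s]. *)
Lemma opmean_positive_map_power n m l
    (Phi : {linear 'M[C]_n -> 'M[C]_l}) (Psi : {linear 'M[C]_m -> 'M[C]_l})
    (A : 'M[C]_n) (B : 'M[C]_m) (c s t : R) :
  positive_map Phi -> positive_map Psi -> psdmx A -> psdmx B -> 0 < c ->
  loewner_le (Phi 1%:M) c%:C%:M -> loewner_le (Psi 1%:M) c%:C%:M ->
  0 <= s <= 1 -> 0 < t -> loewner_le t%:C%:M (opmean f (Phi A) (Psi B)) ->
  loewner_le (c `^ (- s) * t `^ (1 + s))%:C%:M
    (opmean f (Phi (mxpow A (1 + s))) (Psi (mxpow B (1 + s)))).
Proof.
move=> pPhi pPsi pA pB c0 lePhi lePsi s01 t0 le_t.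
have pPA := pPhi _ pA; have pPB := pPsi _ pB.
have pPA' := pPhi _ (psd_mxpow A (1 + s)).
have pPB' := pPsi _ (psd_mxpow B (1 + s)).
have [_ _ h] := opmean_inf pPA' pPB'; apply: h => delta delta0.
have [d1 d10 h1] := mxpow_positive_map_slack pPhi pA c0 lePhi s01 delta0.
have [d2 d20 h2] := mxpow_positive_map_slack pPsi pB c0 lePsi s01 delta0.
pose d := Num.min d1 d2.
have d0 : 0 < d by rewrite lt_min d10.
have {h1} hA := h1 d (_ : 0 <= d <= d1).
have {h2} hB := h2 d (_ : 0 <= d <= d2).
rewrite (ltW d0) ge_min lexx in hA; rewrite (ltW d0) ge_min lexx orbT in hB.
have {}hA := hA isT; have {}hB := hB isT.
have pdA := psd_pdD pPA d0; have pdB := psd_pdD pPB d0.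
have [_ /(_ d d0) h3 _] := opmean_inf pPA pPB.
have h4 := ando_hiai f_OM f_pow pdA pdB s01 t0 (loewner_trans le_t h3).
have h5 := opmean_pos_monotone f_OM (pd_mxpow (1 + s) pdA) hA
  (pd_psd (pd_mxpow (1 + s) pdB)) hB.
have cs0 : 0 < c `^ s by apply: powR_gt0.
have pA'd := pd_psd (psd_pdD pPA' delta0).
rewrite (opmean_pos_scale f _ cs0 pA'd) in h5.
have := loewner_scale (powR_ge0 c (- s)) (loewner_trans h4 h5).
rewrite scale_scalar_mx -rmorphM scalerA -rmorphM.
have -> : c `^ (- s) * c `^ s = 1 by rewrite powRN mulVf// gt_eqF.
by rewrite scale1r.
Qed.

End OperatorMean.

(** * The power inequality *)

Section PowerInequality.
Context {R : realType}.
Local Notation C := R[i].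

Lemma lambda_ge0 n (A : 'M[C]_n) : (0 < n)%N -> psdmx A -> 0 <= lambda n A.
Proof.
move=> n0 pA; case: (lambda_minP n0 (psd_herm pA)) => -[j ->] _.
exact: spectrum_ge0.
Qed.

(** Serves the case [c = 0], where division by [c] is impossible: an estimate valid for all positive
    [d] above [c] is carried down to [c]. *)
Lemma le_powR_mul (x y c s : R) : 0 < x -> 0 <= y -> 0 <= c -> 0 <= s ->
  (forall d : R, 0 < d -> c <= d -> x <= d `^ s * y) -> x <= c `^ s * y.
Proof.
move=> x0 y0; rewrite le_eqVlt => /predU1P[<-|c0] s0 h; last exact: h.
have [s_eq0|sN0] := eqVneq s 0.
  by have := h 1 ltr01 ler01; rewrite s_eq0 !powRr0.
have y1 : 0 < y + 1 by rewrite ltr_wpDl.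
have b0 : 0 < x / (y + 1) by rewrite divr_gt0.
(* At this [d] the estimate reads [x <= x y / (y + 1) < x], a contradiction. *)
have := h ((x / (y + 1)) `^ s^-1) (powR_gt0 _ b0) (powR_ge0 _ _).
rewrite -powRrM mulVf// powRr1 ?(ltW b0)// => le.
have : x < x.
  apply: le_lt_trans le _.
  by rewrite mulrAC ltr_pdivrMr// mulrDr mulr1 ltrDl.
by rewrite ltxx.
Qed.

Lemma powR_chain (c x y z q : R) : 0 <= c -> 0 <= x -> 0 <= y -> 1 <= q ->
  x `^ 2 <= c `^ (2 - 1) * y -> y `^ q <= c `^ (q - 1) * z ->
  x `^ (2 * q) <= c `^ (2 * q - 1) * z.
Proof.
move=> c0 x0 y0 q1 h1 h2; have q0 : 0 <= q := le_trans ler01 q1.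
rewrite powRrM.
apply: (@le_trans _ _ ((c `^ (2 - 1) * y) `^ q)).
  by apply: (ge0_ler_powR q0); rewrite ?nnegrE ?powR_ge0 ?mulr_ge0 ?powR_ge0.
rewrite powRM ?powR_ge0// -powRrM.
apply: le_trans (ler_wpM2l (powR_ge0 c _) h2) _.
(* At base 0 the rule for adding exponents needs a nonzero sum; here the sum is [2 q - 1 >= 1]. *)
have qN0 : (2 - 1) * q + (q - 1) != 0 by rewrite gt_eqF//; lra.
rewrite mulrA -powRD; last by rewrite (negPf qN0).
by rewrite (_ : (2 - 1) * q + (q - 1) = 2 * q - 1)//; ring.
Qed.

Variables (n m l : nat) (f : R -> R).
Variables (Phi : {linear 'M[C]_n -> 'M[C]_l}) (Psi : {linear 'M[C]_m -> 'M[C]_l}).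
Hypotheses (l_gt0 : (0 < l)%N) (f_OM : OM_plus1 f).
Hypothesis f_pow : forall x r : R, 0 <= x -> 1 <= r -> f x `^ r <= f (x `^ r).
Hypotheses (Phi_pos : positive_map Phi) (Psi_pos : positive_map Psi).

Let c := Num.max (opnorm (Phi 1%:M)) (opnorm (Psi 1%:M)).

Let c_ge0 : 0 <= c.
Proof.
have pP := Phi_pos (psd1 n).
rewrite /c le_max; apply/orP; left.
have le := psd_le_opnorm pP.
have h := (spectrum_le _ (psd_herm pP)).1 le (Ordinal l_gt0).
exact: le_trans (spectrum_ge0 _ pP) h.
Qed.

Let Phi_le : loewner_le (Phi 1%:M) c%:C%:M.
Proof.
have max_ge (a b : R) : a <= Num.max a b by rewrite le_max lexx.
have le : opnorm (Phi 1%:M) <= c := max_ge _ _.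
exact: loewner_trans (psd_le_opnorm (Phi_pos (psd1 _))) (loewner_scalar l le).
Qed.

Let Psi_le : loewner_le (Psi 1%:M) c%:C%:M.
Proof.
have max_ge (a b : R) : b <= Num.max a b by rewrite le_max lexx orbT.
have le : opnorm (Psi 1%:M) <= c := max_ge _ _.
exact: loewner_trans (psd_le_opnorm (Psi_pos (psd1 _))) (loewner_scalar l le).
Qed.

Let lam A B := lambda l (opmean f (Phi A) (Psi B)).

Lemma lambda_opmean_pow_le2 A B r : psdmx A -> psdmx B -> 1 <= r <= 2 ->
  lam A B `^ r <= c `^ (r - 1) * lam (mxpow A r) (mxpow B r).
Proof.
move=> pA pB /andP[r1 r2].
have [pK _ _] := opmean_inf f_OM (Phi_pos pA) (Psi_pos pB).
have [pK' _ _] := opmean_inf f_OM (Phi_pos (psd_mxpow A r)) (Psi_pos (psd_mxpow B r)).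
have mu0 := lambda_ge0 l_gt0 pK'; have := lambda_ge0 l_gt0 pK.
(* Ando-Hiai rescales by the inverse of the lower bound, so a zero eigenvalue is set apart; there
   the left side is 0 because [r >= 1]. *)
rewrite -/(lam A B) -/(lam _ _) le_eqVlt => /predU1P[<-|lam0].
  rewrite powR0 ?gt_eqF ?(lt_le_trans ltr01)//.
  exact: mulr_ge0 (powR_ge0 _ _) mu0.
have lr0 := powR_gt0 r lam0.
have s0 : 0 <= r - 1 by rewrite subr_ge0.
apply: (le_powR_mul lr0 mu0 c_ge0 s0) => d d0 cd; have le_d := loewner_scalar l cd.
have s01 : 0 <= r - 1 <= 1 by rewrite subr_ge0 r1 lerBlDr.
have r_eq : 1 + (r - 1) = r by rewrite addrC subrK.
have := opmean_positive_map_power f_OM f_pow Phi_pos Psi_pos pA pB d0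
  (loewner_trans Phi_le le_d) (loewner_trans Psi_le le_d) s01 lam0
  (lambda_lower l_gt0 (psd_herm pK)).
rewrite r_eq => /(le_lambda l_gt0 (psd_herm pK')).
by rewrite powRN mulrC ler_pdivrMr ?powR_gt0// mulrC.
Qed.

Lemma lambda_opmean_pow A B r : psdmx A -> psdmx B -> 1 <= r ->
  lam A B `^ r <= c `^ (r - 1) * lam (mxpow A r) (mxpow B r).
Proof.
move=> pA pB r1.
have [k rk] : exists k : nat, r <= 2 ^+ k.+1.
  exists (Num.bound r); apply/ltW.
  apply: lt_trans (archi_boundP (le_trans ler01 r1)) _.
  move: (Num.bound r) => N; rewrite -natrX ltr_nat.
  exact: ltn_trans (ltnSn N) (ltn_expl N.+1 (ltnSn 1)).
(* [A] and [B] must vary, as the induction hypothesis is used at their squares with exponent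
   [r / 2]. *)
elim: k r A B pA pB r1 rk => [|k IH] r A B pA pB r1 rk.
  by apply: lambda_opmean_pow_le2 => //; rewrite r1.
have [r2|r2] := leP r 2.
  by apply: lambda_opmean_pow_le2 => //; rewrite r1.
pose q := r / 2; have rE : r = 2 * q by rewrite /q mulrC divfK// pnatr_eq0.
have q1 : 1 <= q by rewrite ler_pdivlMr// mul1r ltW.
have q0 : 0 <= q := le_trans ler01 q1.
have qk : q <= 2 ^+ k.+1 by rewrite ler_pdivrMr// -exprSr.
have h1 := @lambda_opmean_pow_le2 A B 2 pA pB _.
have {}h1 : lam A B `^ 2 <= c `^ (2 - 1) * lam (mxpow A 2) (mxpow B 2).
  by apply: h1; rewrite lexx ler1n.
have h2 := IH q _ _ (psd_mxpow A 2) (psd_mxpow B 2) q1 qk.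
rewrite !mxpow_comp in h2.
have [pAB _ _] := opmean_inf f_OM (Phi_pos pA) (Psi_pos pB).
have [pK _ _] := opmean_inf f_OM (Phi_pos (psd_mxpow A 2)) (Psi_pos (psd_mxpow B 2)).
have mu0 : 0 <= lam (mxpow A 2) (mxpow B 2) := lambda_ge0 l_gt0 pK.
have lam0 : 0 <= lam A B := lambda_ge0 l_gt0 pAB.
rewrite rE in h2 *; exact: powR_chain c_ge0 lam0 mu0 q1 h1 h2.
Qed.

End PowerInequality.

Theorem proposition4p1 (R : realType) (n m l : nat)
  (n_gt0 : (0 < n)%N) (m_gt0 : (0 < m)%N) (l_gt0 : (0 < l)%N)
  (Phi : {linear 'M[R[i]]_n -> 'M[R[i]]_l})
  (Psi : {linear 'M[R[i]]_m -> 'M[R[i]]_l})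
  (Phi_pos : positive_map Phi) (Psi_pos : positive_map Psi)
  (f : R -> R) (f_OM : OM_plus1 f)
  (f_pow : forall x r : R, 0 <= x -> 1 <= r -> f x `^ r <= f (x `^ r))
  (A : 'M[R[i]]_n) (B : 'M[R[i]]_m) (A_psd : psdmx A) (B_psd : psdmx B)
  (r : R) (r_ge1 : 1 <= r) :
  lambda l (opmean f (Phi A) (Psi B)) `^ r <=
  Num.max (opnorm (Phi 1%:M)) (opnorm (Psi 1%:M)) `^ (r - 1)
    * lambda l (opmean f (Phi (mxpow A r)) (Psi (mxpow B r))).
Proof.
exact: (lambda_opmean_pow l_gt0 f_OM f_pow Phi_pos Psi_pos A_psd B_psd r_ge1).
Qed.
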